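(* Let $G$ be a compact group such that $Ext_{tfu}(X,G)=0$ for all groups $X\in\ell$. Then $G\cong(\mathbb{R}/\mathbb{Z})^{\sigma}\oplus\mathbb{R}^{n}\oplus M$, where $n$ is a positive integer, $\sigma$ is a cardinal number, and $M$ is a direct product of finite cyclic groups.
   Context: All groups are Hausdorff topological abelian groups, written additively. $\ell$ is the category of locally compact abelian (LCA) groups with continuous homomorphisms as morphisms, and $\cong$ denotes topological isomorphism. A morphism is proper if it is open onto its image. An extension of $A$ by $C$ in $\ell$ is a short exact sequence $0\to A\stackrel{\phi}{\to}B\stackrel{\psi}{\to}C\to 0$ in $\ell$ in which $\phi$ and $\psi$ are proper morphisms. For a group $G$, $G^{(1)}=\bigcap_{m\ge 1}mG$ is the first Ulm subgroup, and $\overline{S}$ denotes the closure of $S$. Such an extension is a $TFU$ extension if $0\to\overline{A^{(1)}}\stackrel{\overline{\phi}}{\to}\overline{B^{(1)}}\stackrel{\overline{\psi}}{\to}\overline{C^{(1)}}\to 0$ is an extension, where $\overline{\phi}=\phi|_{\overline{A^{(1)}}}$ and $\overline{\psi}=\psi|_{\overline{B^{(1)}}}$. Two extensions $0\to A\stackrel{\phi_1}{\to}B\stackrel{\psi_1}{\to}C\to 0$ and $0\to A\stackrel{\phi_2}{\to}X\stackrel{\psi_2}{\to}C\to 0$ are equivalent if there is a topological isomorphism $\beta:B\to X$ with $\beta\phi_1=\phi_2$ and $\psi_2\beta=\psi_1$. An extension splits if it is equivalent to the trivial extension $0\to A\to A\oplus C\to C\to 0$. $Ext_{tfu}(C,A)$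 is the class of all equivalence classes of $TFU$ extensions of $A$ by $C$, and $Ext_{tfu}(C,A)=0$ means that every $TFU$ extension of $A$ by $C$ splits. $\mathbb{R}$ is the additive group of real numbers with its usual topology, $(\mathbb{R}/\mathbb{Z})^{\sigma}$ is the direct product of $\sigma$ copies of the circle group with the product topology, and a direct product of finite cyclic groups carries the product topology.
   Formalization: The integer n is allowed to be 0 instead of being positive: the trivial group G = 0 is compact and satisfies the hypothesis, but no compact group has a direct factor R^n with n ≥ 1. *)

(* Defs.v *)
From HB Require Import structures.
From mathcomp Require Import all_boot all_order all_algebra ring_quotient.
From mathcomp Require Import all_classical all_reals all_analysis.

Set Implicit Arguments.
Unset Strict Implicit.
Unset Printing Implicit Defensive.

Import Order.TTheory GRing.Theory Num.Theory.
Import numFieldNormedType.Exports.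

Local Open Scope classical_set_scope.
Local Open Scope ring_scope.

(* The canonical structures of MathComp-Analysis on [A * C] are keyed on
   topological vector spaces, hence the alias. *)
Definition dirsum (A C : Type) : Type := (A * C)%type.

Section Dirsum.
Variables A C : topologicalZmodType.

HB.instance Definition _ := Topological.copy (dirsum A C) (A * C)%type.
HB.instance Definition _ := GRing.Zmodule.copy (dirsum A C) (A * C)%type.

Lemma dirsum_sub_continuous :
  continuous (fun x : dirsum A C * dirsum A C => x.1 - x.2).
Proof.
move=> [/= x y] /= U /= [] [P Q] /= [nP nQ] nU.
have [/= P0 [P1 P2] sP] := @sub_continuous A (x.1, y.1) _ nP.
have [/= Q0 [Q1 Q2] sQ] := @sub_continuous C (x.2, y.2) _ nQ.
exists ([set z | P0.1 z.1 /\ Q0.1 z.2], [set z | P0.2 z.1 /\ Q0.2 z.2]).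
  by split; [exists (P0.1, Q0.1)|exists (P0.2, Q0.2)].
move=> [[x1 y1] [x2 y2]] /= [] [] a1 b1 [] a2 b2.
by apply: nU; split; [exact: (sP (x1, x2))|exact: (sQ (y1, y2))].
Qed.

HB.instance Definition _ :=
  PreTopologicalNmodule_isTopologicalZmodule.Build (dirsum A C)
    dirsum_sub_continuous.

End Dirsum.

Section DirectProduct.
Variables (I : Type) (K : I -> topologicalZmodType).
Local Notation P := (prod_topology K).
Implicit Types f g h : P.

Let zero : P := fun i => 0.
Let opp f : P := fun i => - f i.
Let add f g : P := fun i => f i + g i.

Let addA : associative add.
Proof. by move=> f g h; apply: functional_extensionality_dep => i; exact: addrA. Qed.
Let addC : commutative add.
Proof. by move=> f g; apply: functional_extensionality_dep => i; exact: addrC. Qed.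
Let add0 : left_id zero add.
Proof. by move=> f; apply: functional_extensionality_dep => i; exact: add0r. Qed.
Let addN : left_inverse zero opp add.
Proof. by move=> f; apply: functional_extensionality_dep => i; exact: addNr. Qed.

HB.instance Definition _ := GRing.isZmodule.Build P addA addC add0 addN.

Lemma prod_sub_continuous : continuous (fun x : P * P => x.1 - x.2).
Proof.
have pi_cont i : continuous (fun f : P => f i).
  move=> f A nA; have /cvg_sup/(_ i) : nbhs f --> f by exact: cvg_id.
  by apply; exact: (@initial_continuous P (K i) (fun g => g i) f A nA).
move=> x; apply/cvg_sup => i A [B [[W oW <-] Wx BA]].
apply: filterS BA _; suff : continuous (fun y : P * P => y.1 i - y.2 i).
  by move/(_ x); apply; exact: open_nbhs_nbhs.
move=> y; apply: (@continuous_comp _ _ _ (fun y : P * P => (y.1 i, y.2 i))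
  (fun z : K i * K i => z.1 - z.2)); last exact: sub_continuous.
apply: cvg_pair.
  by apply: (continuous_comp (g := fun f : P => f i)); [exact: cvg_fst|exact: pi_cont].
by apply: (continuous_comp (g := fun f : P => f i)); [exact: cvg_snd|exact: pi_cont].
Qed.

HB.instance Definition _ :=
  PreTopologicalNmodule_isTopologicalZmodule.Build P prod_sub_continuous.

End DirectProduct.

Section Discrete.
Variable T : zmodType.

HB.instance Definition _ := GRing.Zmodule.copy (discrete_topology T) T.

Lemma discrete_sub_continuous :
  continuous (fun x : discrete_topology T * discrete_topology T => x.1 - x.2).
Proof.
move=> x; apply/discrete_cvg; exists ([set x.1], [set x.2]) => /=.
  by split; exact: discrete_set1.
by move=> [a b] /= [-> ->].
Qed.

HB.instance Definition _ :=
  PreTopologicalNmodule_isTopologicalZmodule.Build (discrete_topology T)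
    discrete_sub_continuous.

End Discrete.

Section QuotientGroup.
Variables (T : topologicalZmodType) (H : zmodClosed T).
Local Notation Q := (quotient_topology {ideal_quot H}).

HB.instance Definition _ := GRing.isZmodule.Build Q
  (@Quotient.addqA T H) (@Quotient.addqC T H)
  (@Quotient.add0q T H) (@Quotient.addNq T H).

Let pi : T -> Q := \pi_Q%qT.

Let piB x y : pi (x - y) = pi x - pi y.
Proof. by rewrite /pi [LHS]Quotient.pi_add Quotient.pi_opp. Qed.

Let pi_continuous : continuous pi.
Proof. exact: pi_continuous. Qed.

Let pi_nbhs x (U : set T) : nbhs x U -> nbhs (pi x) (pi @` U).
Proof.
rewrite nbhsE => -[V [oV Vx] VU]; rewrite nbhsE; exists (pi @` V); last first.
  exact: image_subset.
split; last by exists x.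
rewrite /open /= /quotient_open openE => y /= [v Vv pvy].
have c : continuous (fun z : T => z - (y - v)).
  move=> z; apply: (@continuous_comp _ _ _ (fun z : T => (z, y - v))
    (fun z : T * T => z.1 - z.2)); last exact: sub_continuous.
  by apply: cvg_pair; [exact: cvg_id|exact: cvg_cst].
have nV : nbhs (y - (y - v)) V by rewrite subKr; exact: open_nbhs_nbhs.
apply: (@filterS _ (nbhs y) _ _ _ _ (c y V nV)) => z /= Vz; exists (z - (y - v)) => //.
rewrite !piB pvy.
have -> : \pi_Q%qT y = pi y by [].
by rewrite subrr subr0.
Qed.

Lemma quotient_sub_continuous : continuous (fun x : Q * Q => x.1 - x.2).
Proof.
move=> [p q] A /=; rewrite -[p]reprK -[q]reprK => nA.
have : nbhs (repr p - repr q) (pi @^-1` A).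
  by have := @pi_continuous (repr p - repr q) A; apply; rewrite piB.
move=> /(@sub_continuous T (repr p, repr q)) [[P1 P2] /= [nP1 nP2] sP].
exists (pi @` P1, pi @` P2); first by split; exact: pi_nbhs.
move=> [_ _] /= [[x Px <-] [y Py <-]].
by have /= := sP (x, y) (conj Px Py); rewrite piB.
Qed.

HB.instance Definition _ :=
  PreTopologicalNmodule_isTopologicalZmodule.Build Q quotient_sub_continuous.

End QuotientGroup.

Section Circle.
Variable R : realType.

Definition int_subgroup : zmodClosed R :=
  GRing.ZmodClosed.clone R (@Num.int_num_subdef R) _.

Lemma int_subgroupE x : (x \in int_subgroup) = (x \is a Num.int).
Proof. by []. Qed.

Definition circle := quotient_topology {ideal_quot int_subgroup}.
HB.instance Definition _ := TopologicalZmodule.on circle.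

End Circle.

Definition LCA (G : topologicalZmodType) : Prop :=
  hausdorff_space G /\ locally_compact [set: G].

Definition topological_iso (A B : topologicalZmodType) (f : {additive A -> B}) :
    Prop :=
  continuous f /\
  exists2 g : B -> A, continuous g & cancel f g /\ cancel g f.

Definition isomorphic (A B : topologicalZmodType) : Prop :=
  exists f : {additive A -> B}, topological_iso f.

Definition ulm1 (G : topologicalZmodType) : set G :=
  \bigcap_(m in [set m : nat | (0 < m)%N]) [set x *+ m | x in [set: G]].

Arguments ulm1 : clear implicits.

(* The restriction of [f] to [S] is open onto its image: both the relatively
   open sets of [S] and those of [f @` S] are taken in the subspace topology. *)
Definition proper_on (A B : topologicalType) (S : set A) (f : A -> B) : Prop :=
  forall U : set A, open (U : set (subspace S)) ->
    open (f @` (S `&` U) : set (subspace (f @` S))).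

(* [0 -> SA -> SB -> SC -> 0] is an extension, where the maps are the
   restrictions of [phi] and [psi] to the subgroups [SA], [SB], [SC] with their
   subspace topologies. *)
Record extension_on (A B C : topologicalZmodType)
    (SA : set A) (SB : set B) (SC : set C)
    (phi : {additive A -> B}) (psi : {additive B -> C}) : Prop := ExtensionOn {
  ext_phi_continuous : {within SA, continuous phi};
  ext_psi_continuous : {within SB, continuous psi};
  ext_phi_proper : proper_on SA phi;
  ext_psi_proper : proper_on SB psi;
  ext_phi_inj : set_inj SA phi;
  ext_exact : phi @` SA = SB `&` psi @^-1` [set 0];
  ext_psi_surj : psi @` SB = SC
}.

Definition extension (A B C : topologicalZmodType)
    (phi : {additive A -> B}) (psi : {additive B -> C}) : Prop :=
  extension_on [set: A] [set: B] [set: C] phi psi.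

Definition tfu_extension (A B C : topologicalZmodType)
    (phi : {additive A -> B}) (psi : {additive B -> C}) : Prop :=
  extension phi psi /\
  extension_on (closure (ulm1 A)) (closure (ulm1 B)) (closure (ulm1 C)) phi psi.

Definition equivalent_extensions (A B X C : topologicalZmodType)
    (phi1 : A -> B) (psi1 : B -> C) (phi2 : A -> X) (psi2 : X -> C) : Prop :=
  exists beta : {additive B -> X},
    [/\ topological_iso beta, beta \o phi1 =1 phi2 & psi2 \o beta =1 psi1].

Definition splits (A B C : topologicalZmodType)
    (phi : A -> B) (psi : B -> C) : Prop :=
  equivalent_extensions phi psi
    (fun a => (a, 0) : dirsum A C) (fun x : dirsum A C => x.2).

Definition Ext_tfu_trivial (C A : topologicalZmodType) : Prop :=
  forall (B : topologicalZmodType) (phi : {additive A -> B})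
         (psi : {additive B -> C}),
    LCA B -> tfu_extension phi psi -> splits phi psi.

(* Main.v *)
(* Every extension B of Z/n by G has B^(1) = G^(1), so it is TFU, and its
   splitting makes G divisible by n.  Since G is then divisible, B^(1) is the
   preimage of X^(1) in every extension B of X by G; in particular G is a direct
   summand of each divisible LCA group in which it embeds.  Continuous
   characters separate the points of G, so G is a retract of a torus T^I.  The
   characters of T^I are the finite integer combinations of the coordinates; for
   a well-ordering of I, those factoring through the retraction are generated by
   a triangular family (chi_i), one for each index that occurs as a leading
   coordinate.  Generation makes (chi_i) injective on G, and triangularity with
   the divisibility of T makes it surjective, so G is a torus; n = 0 and M = 0.

   Characters are obtained without Haar measure or complex scalars.  Finite
   averages of translates of a continuous function come uniformly close to a
   constant, its mean.  Convolution by a suitable even function has, by power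
   iteration, a positive definite eigenfunction v with v(0) = 1; among these, one
   maximising the mean of v^2 is an extreme point, hence solves d'Alembert's
   equation v(x+y) + v(x-y) = 2 v(x) v(y) and is the real part of a character. *)

Require Import Defs.
From HB Require Import structures.
From mathcomp Require Import all_boot all_order all_algebra.
From mathcomp Require Import all_classical all_reals all_analysis.
From mathcomp Require Import wochoice ring lra zify.

Set Implicit Arguments.
Unset Strict Implicit.
Unset Printing Implicit Defensive.

Import Order.TTheory GRing.Theory Num.Theory.
Import numFieldNormedType.Exports.

Local Open Scope classical_set_scope.
Local Open Scope ring_scope.

(** Only two kinds of quotient [X] are ever tested: those of finite exponent, and the quotient of a
    torus by [G]. The hard part is to embed [G] in a torus. The eigenvalue problem is posed for the
    square of the convolution operator: its odd iterates are autocorrelations, hence positive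
    definite, and ratios of consecutive squared norms increase by Cauchy-Schwarz, so the eigenvalue
    is a supremum and no sign has to be chosen. Tychonoff's theorem gives pointwise cluster points,
    and a modulus of continuity inherited from the kernel makes the approximation uniform. Since
    only the real part of a character is real valued, the target is d'Alembert's equation instead of
    multiplicativity; 2-divisibility then provides a point where the cosine is neither 1 nor -1,
    from which a sine can be defined. The triangular family is the transfinite proof that a subgroup
    of a free abelian group is free, run on characters; with compactness it does the work of duality
    theory. *)

Lemma compact_finite_net (X : topologicalType) (P : X -> X -> Prop) :
  compact [set: X] -> (forall b, \forall x \near b, P b x) ->
  exists s : seq X, forall x, exists2 b, b \in s & P b x.
Proof.
move=> /compact_near_coveringP cX HP.
(* Lists containing a given list form a filter, so the near-covering form of compactness yields one
   list that serves every point. *)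
pose F : set_system (seq X) :=
  filter_from setT (fun s0 : seq X => [set s : seq X | {subset s0 <= s}]).
have FF : Filter F.
  apply: filter_from_filter; first by exists [::].
  move=> s t _ _; exists (s ++ t) => // u /= stu; split=> x xs; apply: stu;
    by rewrite mem_cat xs ?orbT.
have [|s _ sP] := cX _ F (fun s x => exists2 b, b \in s & P b x) FF.
  move=> x _; exists ([set y | P x y], [set s : seq X | {subset [:: x] <= s}]) => /=.
    by split; [exact: HP|exists [:: x]].
  by move=> [y s] /= [Pxy sx]; exists x => //; apply: sx; rewrite inE.
by exists s => x; exact: (sP s).
Qed.

(** * Continuity and compactness in topological groups *)

Section ContinuousMaps.
Variables (T : topologicalType) (G : topologicalZmodType).

Lemma continuous_addr (f g : T -> G) :
  continuous f -> continuous g -> continuous (fun x => f x + g x).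
Proof.
move=> cf cg x.
apply: (@continuous_comp _ _ _ (fun x => (f x, g x)) (fun z : G * G => z.1 + z.2)).
  by apply: cvg_pair; [exact: cf|exact: cg].
exact: add_continuous.
Qed.

Lemma continuous_subr (f g : T -> G) :
  continuous f -> continuous g -> continuous (fun x => f x - g x).
Proof.
move=> cf cg x.
apply: (@continuous_comp _ _ _ (fun x => (f x, g x)) (fun z : G * G => z.1 - z.2)).
  by apply: cvg_pair; [exact: cf|exact: cg].
exact: sub_continuous.
Qed.

End ContinuousMaps.

Section Translations.
Variable G : topologicalZmodType.

Lemma continuous_addrr (a : G) : continuous (fun x : G => x + a).
Proof. by apply: continuous_addr => x; [exact: cvg_id|exact: cvg_cst]. Qed.

Lemma continuous_oppr : continuous (fun x : G => - x).
Proof. exact: opp_continuous. Qed.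

Lemma nbhs_addr (x : G) (U : set G) :
  nbhs (0 : G) U -> nbhs x [set y | U (y - x)].
Proof.
move=> nU; have := @continuous_addrr (- x) x U.
by rewrite subrr; apply.
Qed.

Lemma compact_cover_translates (U : set G) : compact [set: G] ->
  nbhs (0 : G) U -> exists2 s : seq G, s != [::] &
    forall x, exists2 b, b \in s & U (x + b).
Proof.
move=> cG nU.
have [b|s Hs] := @compact_finite_net G (fun b x => U (x - b)) cG _.
  exact: nbhs_addr.
exists (map -%R s) => [|x].
  by have [b + _] := Hs 0; case: (s).
have [b bs Ub] := Hs x; exists (- b) => //.
by apply/mapP; exists b.
Qed.

End Translations.

(** A tube argument: smallness near [(x, 0)] for each [x] gives, by compactness, one neighbourhood
    of 0 valid for all [x]. *)
Lemma uniformly_continuous (R : realType) (G : topologicalZmodType)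
    (f : G -> R) (e : R) :
  compact [set: G] -> continuous f -> 0 < e ->
  \forall u \near (0 : G), forall x, `|f (x + u) - f x| < e.
Proof.
move=> /compact_near_coveringP cG cf e0.
have : \forall u \near (0 : G), [set: G] `<=` (fun x => `|f (x + u) - f x| < e).
  apply: (cG G) => x _.
  have c : continuous (fun z : G * G => `|f (z.1 + z.2) - f z.1|).
    move=> z; apply: cvg_norm; apply: cvgB.
      apply: (@continuous_comp _ _ _ (fun z : G * G => z.1 + z.2) f).
        exact: add_continuous.
      exact: cf.
    by apply: continuous_comp; [exact: cvg_fst|exact: cf].
  have := c (x, 0); rewrite /continuous_at /= addr0 subrr normr0.
  move=> /cvgr_lt/(_ e e0)[[A B] /= [nA nB] AB].
  by exists (A, B).
by apply: filterS => u H x; exact: H.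
Qed.

Lemma compact_fun_bounded (R : realType) (X : topologicalType) (f : X -> R) :
  compact [set: X] -> continuous f -> exists2 M, 0 < M & forall x, `|f x| <= M.
Proof.
move=> cX cf.
have [b|s Hs] := @compact_finite_net X (fun b x => `|f x - f b| < 1) cX _.
  have : (fun x => `|f x - f b|) @ b --> `|f b - f b|.
    by apply: cvg_norm; apply: cvgB; [exact: cf|exact: cvg_cst].
  by rewrite subrr normr0 => /cvgr_lt/(_ 1 ltr01).
exists (1 + \sum_(b <- s) `|f b|).
  by apply: ltr_pwDl => //; exact: sumr_ge0.
move=> x; have [b bs fb] := Hs x.
rewrite -(subrK (f b) (f x)); apply: le_trans (ler_normD _ _) _.
apply: lerD; first exact: ltW.
by rewrite (big_rem b) //= lerDl; exact: sumr_ge0.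
Qed.

(** * The invariant mean of a compact group *)

Section Averages.
Variables (R : realType) (G : zmodType).
Implicit Types (f g : G -> R) (s t : seq G).

Definition avg s f : G -> R :=
  fun x => (size s)%:R^-1 * \sum_(a <- s) f (x + a).

Lemma size_gt0 s : s != [::] -> 0 < (size s)%:R :> R.
Proof. by case: s => // a s _; rewrite ltr0n. Qed.

Lemma avg_comp s t f :
  avg s (avg t f) = avg [seq a + b | a <- s, b <- t] f.
Proof.
apply/funext => x; rewrite /avg size_allpairs big_allpairs_dep /=.
rewrite natrM invfM -mulrA; congr (_ * _); rewrite mulr_sumr.
by apply: eq_bigr => a _; congr (_ * _); apply: eq_bigr => b _; rewrite addrA.
Qed.

(** This is where commutativity of the group enters; uniqueness and additivity of the mean and the
    exchange of two means rest on it. *)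
Lemma avgC s t f : avg s (avg t f) = avg t (avg s f).
Proof.
apply/funext => x; rewrite /avg mulr_sumr.
under eq_bigr do rewrite mulrCA mulr_sumr.
rewrite -mulr_sumr exchange_big /=; congr (_ * _).
apply: eq_bigr => a _; rewrite mulr_sumr.
by apply: eq_bigr => b _; rewrite addrAC.
Qed.

Lemma allpairs_neq0 s t :
  s != [::] -> t != [::] -> [seq a + b | a <- s, b <- t] != [::].
Proof. by case: s => // a s; case: t. Qed.

Lemma avgD s f g : avg s (fun x => f x + g x) = fun x => avg s f x + avg s g x.
Proof. by apply/funext => x; rewrite /avg big_split mulrDr. Qed.

Lemma avgZ s c f : avg s (fun x => c * f x) = fun x => c * avg s f x.
Proof. by apply/funext => x; rewrite /avg -mulr_sumr mulrCA. Qed.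

Lemma avg_le s f g : (forall x, f x <= g x) -> forall x, avg s f x <= avg s g x.
Proof.
move=> fg x; rewrite /avg ler_wpM2l ?invr_ge0 ?ler0n//.
by apply: ler_sum => a _.
Qed.

Lemma avg_cst s c : s != [::] -> avg s (cst c) = cst c.
Proof.
move=> s0; apply/funext => x; rewrite /avg /cst big_const_seq count_predT.
rewrite iter_addr_0 -[c *+ _]mulr_natl mulrA mulVf ?mul1r//.
by rewrite gt_eqF// size_gt0.
Qed.

Lemma avg_ge s f m : s != [::] -> (forall x, m <= f x) -> forall x, m <= avg s f x.
Proof. by move=> s0 H x; rewrite -[m](congr1 (@^~ x) (avg_cst m s0)); exact: avg_le. Qed.

Lemma avg_leM s f m : s != [::] -> (forall x, f x <= m) -> forall x, avg s f x <= m.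
Proof.
move=> s0 H x; rewrite -[leRHS](congr1 (@^~ x) (avg_cst m s0)).
exact: avg_le.
Qed.

Lemma avg_dist s f g e : s != [::] ->
  (forall x, `|f x - g x| <= e) -> forall x, `|avg s f x - avg s g x| <= e.
Proof.
move=> s0 H x; have -> : avg s f x - avg s g x = avg s (fun x => f x - g x) x.
  by rewrite /avg -mulrBr sumrB.
rewrite ler_norml; apply/andP; split.
  by apply: avg_ge => // y; move: (H y); rewrite ler_norml => /andP[].
by apply: avg_leM => // y; move: (H y); rewrite ler_norml => /andP[].
Qed.

Lemma avg_shift s f a : avg s (fun x => f (x + a)) = fun x => avg s f (x + a).
Proof.
by apply/funext => x; rewrite /avg; congr (_ * _); apply: eq_bigr => b _; rewrite addrAC.
Qed.

Lemma avg_opp s f : avg s (fun x => f (- x)) = fun x => avg (map -%R s) f (- x).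
Proof.
apply/funext => x; rewrite /avg size_map big_map; congr (_ * _).
by apply: eq_bigr => b _; rewrite opprD.
Qed.

(** One translate with value at most [M'] lowers the trivial bound [M] in proportion to its weight
    in the average. *)
Lemma avg_one_le s f M M' b x : b \in s ->
  (forall x, f x <= M) -> f (x + b) <= M' ->
  avg s f x <= M - (M - M') / (size s)%:R.
Proof.
move=> bs fM fM'.
have s0 : s != [::] by case: s bs.
have N0 := size_gt0 s0.
rewrite /avg mulrC ler_pdivrMr// mulrBl divfK ?gt_eqF//.
have -> : M * (size s)%:R - (M - M') = M' + M * (size (rem b s))%:R.
  rewrite size_rem// -[in LHS](prednK (n := size s)) ?lt0n ?size_eq0//.
  by rewrite -natr1; ring.
rewrite (big_rem b)//=; apply: lerD => //.
apply: (@le_trans _ _ (\sum_(a <- rem b s) M)); first exact: ler_sum.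
by rewrite big_const_seq count_predT iter_addr_0 mulr_natr.
Qed.

End Averages.

Section Mean.
Variables (R : realType) (G : topologicalZmodType).
Hypothesis cG : compact [set: G].
Implicit Types f g : G -> R.

Definition is_mean f c := forall e : R, 0 < e ->
  exists2 s : seq G, s != [::] & forall x, `|avg s f x - c| <= e.

(* Averaging over translates that cover [G] shrinks the oscillation [w]: every
   point has a translate near a point where [g] is small. *)
Lemma avg_contraction g (m w eta : R) (U : set G) (s : seq G) :
  s != [::] -> (forall x, exists2 b, b \in s & U (x + b)) -> 0 <= eta -> 0 <= w ->
  (forall u x, U u -> `|g (x + u) - g x| <= eta) ->
  (forall x, m <= g x <= m + w) ->
  exists m', forall x,
    m' <= avg s g x <= m' + (w - (w / 2 - eta) / (size s)%:R).
Proof.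
move=> s0 sU eta0 w0 gU gm.
have N0 : 0 < (size s)%:R :> R := size_gt0 R s0.
have N1 : 1 <= (size s)%:R :> R by rewrite ler1n lt0n size_eq0.
have [[x0 gx0]|H] := pselect (exists x0, g x0 <= m + w / 2).
  exists m => x; apply/andP; split.
    by apply: avg_ge => // y; have /andP[] := gm y.
  have [b bs Ub] := sU (x - x0).
  have gb : g (x + b) <= m + w / 2 + eta.
    have := gU _ x0 Ub; rewrite addrA (addrC x0) subrK ler_norml.
    by move: gx0; lra.
  apply: le_trans (avg_one_le (M := m + w) bs _ gb) _.
    by move=> y; have /andP[_] := gm y.
  by rewrite -addrA !lerD2l lerN2 ler_pM2r ?invr_gt0//; lra.
(* No value lies below the midpoint, so the lower bound rises by [w / 2], which is at least the
   required gain. *)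
exists (m + w / 2) => x; apply/andP; split.
  by apply: avg_ge => // y; rewrite leNgt; apply/negP => /ltW gy; apply: H; exists y.
apply: (@le_trans _ _ (m + w)).
  by apply: avg_leM => // y; have /andP[] := gm y.
have h : (w / 2 - eta) / (size s)%:R <= w / 2.
  rewrite ler_pdivrMr//; apply: (@le_trans _ _ (w / 2)); first lra.
  by rewrite ler_peMr// divr_ge0.
lra.
Qed.

(** Averaging preserves a modulus of continuity, so the neighbourhood found for [f] serves all its
    averages and one covering list contracts every one of them. *)
Lemma avg_small_osc f (e : R) : continuous f -> 0 < e ->
  exists2 s : seq G, s != [::] & exists m, forall x, m <= avg s f x <= m + e.
Proof.
move=> cf e0.
pose W := [set w : R | exists2 s : seq G, s != [::] &
  exists m, forall x, m <= avg s f x <= m + w].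
have W0 w : W w -> 0 <= w.
  by move=> [s _ [m /(_ 0)/andP[]]]; lra.
have hW : has_inf W.
  split; last by exists 0 => w /W0.
  have [M M0 fM] := compact_fun_bounded cG cf.
  exists (2 * M); exists [:: 0] => //; exists (- M) => x.
  have -> : avg [:: 0] f x = f x by rewrite /avg big_seq1 addr0 invr1 mul1r.
  have := fM x; rewrite ler_norml => /andP[? ?]; lra.
have [ltw|lew] := ltP (inf W) e.
  have [w [s s0 [m sm]] we] := inf_adherent (eps := e - inf W) (ltac:(lra)) hW.
  exists s => //; exists m => x; have := sm x; lra.
have e4 : 0 < e / 4 by lra.
have nU := uniformly_continuous cG cf e4.
have [t t0 tU] := compact_cover_translates cG nU.
have N0 := size_gt0 R t0.
(* The gain guaranteed when the infimum is at least [e]: an oscillation below [inf W + d] would be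
   improved to one below [inf W]. *)
set d := (inf W / 2 - e / 4) / (size t)%:R.
have d0 : 0 < d by apply: divr_gt0 => //; lra.
have [w Ww wd] := inf_adherent d0 hW.
have w0 := W0 _ Ww.
have infW : inf W <= w by exact: (ge_inf hW.2).
case: (Ww) => s s0 [m sm].
have [|m' m'P] := @avg_contraction (avg s f) m w (e / 4)
    (fun u => forall x, `|f (x + u) - f x| < e / 4) t t0 tU (ltW e4) w0 _ sm.
  move=> u x /= Uu; rewrite -[avg s f (x + u)](congr1 (@^~ x) (avg_shift s f u)).
  by apply: avg_dist => // y; exact: ltW.
have : W (w - (w / 2 - e / 4) / (size t)%:R).
  by exists [seq a + b | a <- t, b <- s];
    [exact: allpairs_neq0|exists m' => x; rewrite -avg_comp].
move=> /(ge_inf hW.2).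
have : d <= (w / 2 - e / 4) / (size t)%:R.
  by rewrite ler_pM2r ?invr_gt0//; lra.
lra.
Qed.

Lemma mean_exists f : continuous f -> exists c, is_mean f c.
Proof.
move=> cf.
pose L := [set m : R | exists2 s : seq G, s != [::] & forall x, m <= avg s f x].
(* A lower bound of one average and an upper bound of another are compared through the iterated
   average, because averages commute. *)
have key s m e : s != [::] -> (forall x, m <= avg s f x <= m + e) ->
    ubound L (m + e).
  move=> s0 sm m' [t t0 tm].
  apply: (@le_trans _ _ (avg s (avg t f) 0)); first exact: avg_ge.
  rewrite avgC; apply: avg_leM => // x; by have /andP[] := sm x.
have hL : has_sup L.
  have [s s0 [m sm]] := avg_small_osc cf ltr01.
  split; first by exists m; exists s => // x; have /andP[] := sm x.
  by exists (m + 1); exact: key sm.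
exists (sup L) => e e0.
have [s s0 [m sm]] := avg_small_osc cf e0.
exists s => // x.
have h1 : m <= sup L.
  by apply: ub_le_sup; [exact: hL.2|exists s => // y; have /andP[] := sm y].
have h2 : sup L <= m + e by apply: ge_sup; [exact: hL.1|exact: key sm].
have := sm x; rewrite ler_norml; lra.
Qed.

Lemma is_mean_unique f c d : is_mean f c -> is_mean f d -> c = d.
Proof.
move=> fc fd; apply/eqP; rewrite -subr_eq0 -normr_le0; apply/ler_addgt0Pl => e e0.
rewrite addr0.
have e2 : 0 < e / 2 by lra.
have [s s0 sc] := fc _ e2; have [t t0 td] := fd _ e2.
have h1 : `|avg t (avg s f) 0 - c| <= e / 2.
  have := avg_dist t0 sc 0; by rewrite (avg_cst c t0).
have h2 : `|avg t (avg s f) 0 - d| <= e / 2.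
  rewrite avgC; have := avg_dist s0 td 0; by rewrite (avg_cst d s0).
move: h1 h2; rewrite !ler_norml; lra.
Qed.

(** The 0 is a default for functions without a mean; continuous functions on a compact group always
    have one. *)
Definition mean f : R := xget 0 (is_mean f).

Lemma meanP f : continuous f -> is_mean f (mean f).
Proof. by move=> /mean_exists[c fc]; exact: (xgetPex 0 (ex_intro _ c fc)). Qed.

Lemma mean_eq f c : is_mean f c -> mean f = c.
Proof.
by move=> fc; apply: (is_mean_unique _ fc); exact: (xgetPex 0 (ex_intro _ c fc)).
Qed.

Lemma mean_cst c : mean (cst c) = c.
Proof.
apply: mean_eq => e e0; exists [:: 0] => // x.
by rewrite (avg_cst c) // subrr normr0 ltW.
Qed.

Lemma meanD f g : continuous f -> continuous g ->
  mean (fun x => f x + g x) = mean f + mean g.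
Proof.
move=> cf cg; apply: mean_eq => e e0; have e2 : 0 < e / 2 by lra.
have [s s0 sf] := meanP cf e2; have [t t0 tg] := meanP cg e2.
exists [seq a + b | a <- t, b <- s]; first exact: allpairs_neq0.
move=> x; rewrite -avg_comp !avgD.
have := avg_dist t0 sf x; rewrite (avg_cst _ t0) /= => h1.
have := avg_dist s0 tg x; rewrite (avg_cst _ s0) /= avgC => h2.
by move: h1 h2; rewrite !ler_norml /cst; lra.
Qed.

Lemma meanZ c f : continuous f -> mean (fun x => c * f x) = c * mean f.
Proof.
move=> cf; apply: mean_eq => e e0.
have d0 : 0 < e / (`|c| + 1) by rewrite divr_gt0// ltr_wpDl.
have [s s0 sf] := meanP cf d0.
exists s => // x; rewrite avgZ -mulrBr normrM.
apply: (@le_trans _ _ (`|c| * (e / (`|c| + 1)))).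
  by rewrite ler_wpM2l.
rewrite mulrCA ler_piMr ?(ltW e0)// ler_pdivrMr ?ltr_wpDl// mul1r lerDl.
exact: ler01.
Qed.

Lemma meanB f g : continuous f -> continuous g ->
  mean (fun x => f x - g x) = mean f - mean g.
Proof.
move=> cf cg; rewrite (_ : (fun x => _) = fun x => f x + (-1) * g x); last first.
  by apply/funext => x; rewrite mulN1r.
rewrite meanD// ?meanZ ?mulN1r// => x.
by apply: cvgM; [exact: cvg_cst|exact: cg].
Qed.

Lemma mean_ge0 f : continuous f -> (forall x, 0 <= f x) -> 0 <= mean f.
Proof.
move=> cf f0; apply/ler_addgt0Pl => e e0.
have [s s0 sf] := meanP cf e0.
have h : 0 <= avg s f 0 by exact: avg_ge.
by have := sf 0; rewrite ler_norml; lra.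
Qed.

Lemma mean_le f g : continuous f -> continuous g -> (forall x, f x <= g x) ->
  mean f <= mean g.
Proof.
move=> cf cg fg; rewrite -subr_ge0 -meanB//; apply: mean_ge0.
  by move=> x; apply: cvgB; [exact: cg|exact: cf].
by move=> x; rewrite subr_ge0.
Qed.

Lemma mean_dist f c (e : R) : continuous f -> (forall x, `|f x - c| <= e) ->
  `|mean f - c| <= e.
Proof.
move=> cf fc.
have h1 : mean f <= c + e.
  rewrite -(mean_cst (c + e)); apply: mean_le => //; first by move=> ?; exact: cvg_cst.
  by move=> x; have := fc x; rewrite /cst ler_norml; lra.
have h2 : c - e <= mean f.
  rewrite -(mean_cst (c - e)); apply: mean_le => //; first by move=> ?; exact: cvg_cst.
  by move=> x; have := fc x; rewrite /cst ler_norml; lra.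
by rewrite ler_norml; lra.
Qed.

Lemma mean_norm_le f (M : R) : continuous f -> (forall x, `|f x| <= M) ->
  `|mean f| <= M.
Proof.
move=> cf fM; rewrite -[mean f]subr0; apply: mean_dist => // x.
by rewrite subr0.
Qed.

Lemma mean_shift f a : continuous f -> mean (fun x => f (x + a)) = mean f.
Proof.
move=> cf; apply: mean_eq => e e0; have [s s0 sf] := meanP cf e0.
by exists s => // x; rewrite avg_shift.
Qed.

Lemma mean_opp f : continuous f -> mean (fun x => f (- x)) = mean f.
Proof.
move=> cf; apply: mean_eq => e e0; have [s s0 sf] := meanP cf e0.
exists (map -%R s); first by case: (s) s0.
by move=> x; rewrite avg_opp mapK//; exact: opprK.
Qed.

Lemma continuous_avg s f : continuous f -> continuous (avg s f).
Proof.
move=> cf x; apply: cvgM; first exact: cvg_cst.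
have -> : (fun x => \sum_(a <- s) f (x + a)) = \sum_(a <- s) (fun x => f (x + a)).
  by apply/funext => y; rewrite fct_sumE.
elim: s => [|a s IH]; first by rewrite !big_nil; exact: cvg_cst.
rewrite !big_cons; apply: cvgD => //.
by apply: (@continuous_comp _ _ _ (fun y => y + a) f); [exact: continuous_addrr|exact: cf].
Qed.

Lemma mean_avg s f : s != [::] -> continuous f -> mean (avg s f) = mean f.
Proof.
move=> s0 cf; apply: mean_eq => e e0; have [t t0 tf] := meanP cf e0.
exists t => // x; rewrite avgC; have := avg_dist s0 tf x.
by rewrite (avg_cst _ s0).
Qed.

(** Finitely many translates of a neighbourhood on which [f] exceeds [f x0 / 2] cover [G], so a
    suitable average is bounded below by [f x0 / 2] over the number of translates. This makes the
    inner product below definite. *)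
Lemma mean_gt0 f x0 : continuous f -> (forall x, 0 <= f x) -> 0 < f x0 ->
  0 < mean f.
Proof.
move=> cf f0 fx0.
have f2 : 0 < f x0 / 2 by lra.
have nU := uniformly_continuous cG cf f2.
have [s s0 sU] := compact_cover_translates cG nU.
have N0 := size_gt0 R s0.
rewrite -(mean_avg s0 cf); apply: (@lt_le_trans _ _ (f x0 / 2 / (size s)%:R)).
  exact: divr_gt0.
rewrite -[leLHS](mean_cst); apply: mean_le => //.
- by move=> ?; exact: cvg_cst.
- exact: continuous_avg.
move=> x; rewrite /cst /avg mulrC ler_wpM2l// ?invr_ge0 ?ltW//.
have [b bs /(_ x0)] := sU (x - x0).
rewrite addrA (addrC x0) subrK ltr_norml => /andP[h _].
rewrite (big_rem b)//=.
have : 0 <= \sum_(y <- rem b s) f (x + y) by exact: sumr_ge0.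
lra.
Qed.

End Mean.

(** * Continuity of real-valued functions *)

Section RealContinuity.
Variables (R : realType) (T : topologicalType).
Implicit Types f g : T -> R.

Lemma continuous_addf f g :
  continuous f -> continuous g -> continuous (fun x => f x + g x).
Proof. by move=> cf cg x; apply: cvgD; [exact: cf|exact: cg]. Qed.

Lemma continuous_subf f g :
  continuous f -> continuous g -> continuous (fun x => f x - g x).
Proof. by move=> cf cg x; apply: cvgB; [exact: cf|exact: cg]. Qed.

Lemma continuous_mulf f g :
  continuous f -> continuous g -> continuous (fun x => f x * g x).
Proof. by move=> cf cg x; apply: cvgM; [exact: cf|exact: cg]. Qed.

Lemma continuous_normf f : continuous f -> continuous (fun x => `|f x|).
Proof. by move=> cf x; apply: cvg_norm; exact: cf. Qed.

Lemma continuous_cst (c : R) : continuous (fun _ : T => c).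
Proof. by move=> x; exact: cvg_cst. Qed.

Lemma continuous_sumf (I : Type) (s : seq I) (h : I -> T -> R) :
  (forall i, continuous (h i)) -> continuous (fun x => \sum_(i <- s) h i x).
Proof.
move=> ch.
elim: s => [|i s IH].
  rewrite (_ : (fun x => _) = cst 0); first exact: continuous_cst.
  by apply/funext => x; rewrite big_nil.
rewrite (_ : (fun x => _) = fun x => h i x + \sum_(i <- s) h i x).
  exact: continuous_addf.
by apply/funext => x; rewrite big_cons.
Qed.

End RealContinuity.

Lemma continuous_fcomp (X Y Z : topologicalType) (f : X -> Y) (g : Y -> Z) :
  continuous f -> continuous g -> continuous (fun x => g (f x)).
Proof. by move=> cf cg x; apply: continuous_comp; [exact: cf|exact: cg]. Qed.

Section GroupRealContinuity.
Variables (R : realType) (G : topologicalZmodType).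
Implicit Types f g : G -> R.

Lemma continuous_shift f a : continuous f -> continuous (fun x => f (x + a)).
Proof. by apply: continuous_fcomp; exact: continuous_addrr. Qed.

Lemma continuous_refl f : continuous f -> continuous (fun x => f (- x)).
Proof. by apply: continuous_fcomp; exact: continuous_oppr. Qed.

Lemma continuous_subl f a : continuous f -> continuous (fun x => f (a - x)).
Proof.
apply: continuous_fcomp; apply: continuous_subr => x; [exact: cvg_cst|exact: cvg_id].
Qed.

End GroupRealContinuity.

Ltac cont := repeat lazymatch goal with
  | |- continuous (fun x => @?f x - @?g x) => apply: (@continuous_subf _ _ f g)
  | |- continuous (fun x => @?f x + @?g x) => apply: (@continuous_addf _ _ f g)
  | |- continuous (fun x => @?f x * @?g x) => apply: (@continuous_mulf _ _ f g)
  | |- continuous (fun x => ?f (?a - x)) => apply: (@continuous_subl _ _ f a)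
  | |- continuous (fun x => ?f (x + ?a)) => apply: (@continuous_shift _ _ f a)
  | |- continuous (fun x => ?f (- x)) => apply: (@continuous_refl _ _ f)
  | |- _ => first [assumption | exact: continuous_cst]
  end.

(** * Exchanging two means *)

Section Fubini.
Variables (R : realType) (G : topologicalZmodType).
Hypothesis cG : compact [set: G].
Implicit Types f g : G -> R.

Lemma mean_dist2 f g (e : R) : continuous f -> continuous g ->
  (forall x, `|f x - g x| <= e) -> `|mean f - mean g| <= e.
Proof.
by move=> cf cg fg; rewrite -meanB//; apply: mean_norm_le => //; cont.
Qed.

Lemma mean_sum (I : Type) (s : seq I) (h : I -> G -> R) :
  (forall i, continuous (h i)) ->
  mean (fun x => \sum_(i <- s) h i x) = \sum_(i <- s) mean (h i).
Proof.
move=> ch; elim: s => [|i s IH].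
  rewrite big_nil -[RHS](mean_cst G); congr mean.
  by apply/funext => x; rewrite big_nil.
rewrite big_cons -IH -meanD//; last exact: continuous_sumf.
by congr mean; apply/funext => x; rewrite big_cons.
Qed.

Variable F : G -> G -> R.
Hypothesis cF : continuous (fun z : G * G => F z.1 z.2).

Lemma continuous_curryl y : continuous (fun x => F x y).
Proof.
move=> x; apply: (@continuous_comp _ _ _ (fun x => (x, y)) (fun z => F z.1 z.2)).
  by apply: cvg_pair; [exact: cvg_id|exact: cvg_cst].
exact: cF.
Qed.

Lemma continuous_curryr x : continuous (F x).
Proof.
move=> y; apply: (@continuous_comp _ _ _ (fun y => (x, y)) (fun z => F z.1 z.2)).
  by apply: cvg_pair; [exact: cvg_cst|exact: cvg_id].
exact: cF.
Qed.

Lemma uniformly_continuousl (e : R) : 0 < e ->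
  \forall u \near (0 : G), forall x y, `|F (x + u) y - F x y| < e.
Proof.
(* [dirsum G G] is the square of [G] as a topological group, so uniform continuity on a group
   applies to [F] directly. *)
move=> e0; have cGG : compact [set: dirsum G G].
  by have := compact_setX cG cG; rewrite setXTT.
have := @uniformly_continuous R (dirsum G G) (fun z => F z.1 z.2) e cGG cF e0.
move=> [[A B] /= [nA nB] AB].
apply: filterS nA => u Au x y.
have := AB (u, 0) (conj Au (nbhs_singleton nB)) (x, y).
by rewrite /= addr0.
Qed.

Lemma continuous_mean : continuous (fun x => mean (F x)).
Proof.
move=> x; apply/cvgrPdist_le => e e0.
have := @nbhs_addr _ x _ (uniformly_continuousl e0).
apply: filterS => x' H; apply: mean_dist2; [exact: continuous_curryr..|].
by move=> y; rewrite distrC; have := H x y; rewrite (addrC x) subrK => /ltW.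
Qed.

(** A further average keeps a function close to its mean, so composing the lists of the single
    slices handles finitely many at once. *)
Lemma common_avg (l : seq G) (e : R) : 0 < e -> exists2 s : seq G, s != [::] &
  forall b, b \in l -> forall y, `|avg s (F b) y - mean (F b)| <= e.
Proof.
move=> e0; elim: l => [|a l [s s0 sl]]; first by exists [:: 0].
have [t t0 ta] := meanP cG (@continuous_curryr a) e0.
exists [seq x + y | x <- s, y <- t]; first exact: allpairs_neq0.
move=> b; rewrite inE -avg_comp => /orP[/eqP ->|bl] y.
  by have := avg_dist s0 ta y; rewrite (avg_cst _ s0).
by rewrite avgC; have := avg_dist t0 (sl b bl) y; rewrite (avg_cst _ t0).
Qed.

(** Finitely many slices [F b] approximate all slices [F x], and one list averages them in the
    second variable; this finite average commutes with the mean in the first. *)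
Lemma mean_exchange :
  mean (fun x => mean (F x)) = mean (fun y => mean (fun x => F x y)).
Proof.
apply/esym/mean_eq => e e0; have e4 : 0 < e / 4 by lra.
have [b|l Hl] := @compact_finite_net G
    (fun b x => forall y, `|F x y - F b y| < e / 4) cG _.
  have := @nbhs_addr _ b _ (uniformly_continuousl e4).
  by apply: filterS => x /= H y; have := H b y; rewrite (addrC b) subrK.
have [s s0 sl] := common_avg l e4.
exists s => // y.
have cavg : continuous (fun x => avg s (F x) y).
  apply: continuous_mulf; first exact: continuous_cst.
  by apply: continuous_sumf => a; exact: continuous_curryl.
have -> : avg s (fun y => mean (fun x => F x y)) y = mean (fun x => avg s (F x) y).
  rewrite /avg meanZ//; last by apply: continuous_sumf => a; exact: continuous_curryl.
  by rewrite mean_sum// => a; exact: continuous_curryl.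
apply: mean_dist2 => //; first exact: continuous_mean.
move=> x; have [b bl xb] := Hl x.
have h1 := sl b bl y.
have h2 : `|avg s (F x) y - avg s (F b) y| <= e / 4.
  by apply: avg_dist => // z; exact: ltW.
have h3 : `|mean (F x) - mean (F b)| <= e / 4.
  by apply: mean_dist2; [exact: continuous_curryr..|move=> z; exact: ltW].
move: h1 h2 h3; rewrite !ler_norml; lra.
Qed.

End Fubini.

(** * The inner product and the convolution operator *)

Section Convolution.
Variables (R : realType) (G : topologicalZmodType).
Hypothesis cG : compact [set: G].
Implicit Types f g p : G -> R.

Definition inner f g : R := mean (fun x => f x * g x).

Lemma innerC f g : inner f g = inner g f.
Proof. by congr mean; apply/funext => x; rewrite mulrC. Qed.

Lemma innerDl f g h : continuous f -> continuous g -> continuous h ->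
  inner (fun x => f x + g x) h = inner f h + inner g h.
Proof.
move=> cf cg ch; rewrite /inner -meanD; [|cont..].
by congr mean; apply/funext => x; rewrite mulrDl.
Qed.

Lemma innerZl c f h : continuous f -> continuous h ->
  inner (fun x => c * f x) h = c * inner f h.
Proof.
move=> cf ch; rewrite /inner -meanZ; [|cont..].
by congr mean; apply/funext => x; rewrite mulrA.
Qed.

Lemma innerDr f g h : continuous f -> continuous g -> continuous h ->
  inner h (fun x => f x + g x) = inner h f + inner h g.
Proof. by move=> cf cg ch; rewrite innerC innerDl// !(innerC h). Qed.

Lemma innerZr c f h : continuous f -> continuous h ->
  inner h (fun x => c * f x) = c * inner h f.
Proof. by move=> cf ch; rewrite innerC innerZl// (innerC h). Qed.

Lemma inner_ge0 f : continuous f -> 0 <= inner f f.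
Proof. by move=> cf; apply: mean_ge0 => //; [cont|move=> x; rewrite -expr2 sqr_ge0]. Qed.

Lemma inner_eq0 f : continuous f -> inner f f <= 0 -> forall x, f x = 0.
Proof.
move=> cf ff x; apply/eqP; rewrite -sqrf_eq0; apply/negPn/negP => fx0.
have : 0 < inner f f.
  apply: (@mean_gt0 _ _ cG _ x); first by cont.
    by move=> y; rewrite -expr2 sqr_ge0.
  by rewrite -expr2 lt_def fx0 sqr_ge0.
by rewrite ltNge ff.
Qed.

Lemma inner_expand f g a b : continuous f -> continuous g ->
  inner (fun x => a * f x + b * g x) (fun x => a * f x + b * g x) =
  a ^+ 2 * inner f f + 2 * (a * b) * inner f g + b ^+ 2 * inner g g.
Proof.
move=> cf cg.
rewrite innerDl; [|cont..]. rewrite !innerDr; [|cont..].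
rewrite !innerZl; [|cont..]. rewrite !innerZr; [|cont..].
by rewrite (innerC g f); ring.
Qed.

Lemma inner_CS f g : continuous f -> continuous g ->
  inner f g ^+ 2 <= inner f f * inner g g.
Proof.
move=> cf cg.
have [f0|fn0] := leP (inner f f) 0.
  have f00 := inner_eq0 cf f0.
  have -> : inner f g = 0.
    by rewrite -[RHS](mean_cst G); congr mean; apply/funext => x; rewrite f00 mul0r.
  by rewrite expr0n /= mulr_ge0 ?inner_ge0.
(* The component of [g] orthogonal to [f], scaled by [inner f f] to avoid a division. *)
have h : 0 <= inner (fun x => (- inner f g) * f x + inner f f * g x)
                 (fun x => (- inner f g) * f x + inner f f * g x).
  by apply: inner_ge0; cont.
rewrite inner_expand// in h.
have : 0 <= inner f f * (inner f f * inner g g - inner f g ^+ 2) by apply: le_trans h _; lra.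
by rewrite pmulr_rge0// subr_ge0.
Qed.

Definition even_function f := forall x, f (- x) = f x.

Variable p : G -> R.
Hypotheses (cp : continuous p) (ep : even_function p).

Definition conv g : G -> R := fun x => mean (fun z => p (x - z) * g z).

Lemma continuous_conv_kernel g : continuous g ->
  continuous (fun z : G * G => p (z.1 - z.2) * g z.2).
Proof.
move=> cg; apply: continuous_mulf.
  by apply: (@continuous_fcomp _ _ _ (fun z : G * G => z.1 - z.2)) => //; exact: sub_continuous.
by apply: (@continuous_fcomp _ _ _ snd) => // z; exact: cvg_snd.
Qed.

Lemma continuous_conv g : continuous g -> continuous (conv g).
Proof.
by move=> cg; apply: (@continuous_mean _ _ cG (fun x z => p (x - z) * g z));
  exact: continuous_conv_kernel.
Qed.

Lemma convD f g : continuous f -> continuous g ->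
  conv (fun x => f x + g x) = fun x => conv f x + conv g x.
Proof.
move=> cf cg; apply/funext => x; rewrite /conv -meanD; [|cont..].
by congr mean; apply/funext => z; rewrite mulrDr.
Qed.

Lemma convZ c g : continuous g -> conv (fun x => c * g x) = fun x => c * conv g x.
Proof.
move=> cg; apply/funext => x; rewrite /conv -meanZ; [|cont..].
by congr mean; apply/funext => z; rewrite mulrCA.
Qed.

Lemma conv_shift g a : continuous g ->
  conv (fun x => g (x + a)) = fun x => conv g (x + a).
Proof.
move=> cg; apply/funext => x.
rewrite /conv -[RHS](mean_shift cG a); last by cont.
by congr mean; apply/funext => z; congr (p _ * _); rewrite opprD addrACA subrr addr0.
Qed.

Lemma conv_refl g : continuous g -> conv (fun x => g (- x)) = fun x => conv g (- x).
Proof.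
move=> cg; apply/funext => x.
rewrite /conv -[RHS](mean_opp cG); last by cont.
congr mean; apply/funext => z.
by congr (_ * _); rewrite opprK -[LHS]ep opprB addrC.
Qed.

Lemma conv_even g : continuous g -> even_function g -> even_function (conv g).
Proof.
move=> cg eg x; rewrite -[LHS](congr1 (@^~ x) (conv_refl cg)).
by congr (conv _ _); apply/funext => y; rewrite eg.
Qed.

Lemma conv_selfadjoint f g : continuous f -> continuous g ->
  inner (conv f) g = inner f (conv g).
Proof.
move=> cf cg.
have c : continuous (fun z : G * G => p (z.1 - z.2) * f z.2 * g z.1).
  apply: continuous_mulf; first exact: continuous_conv_kernel.
  by apply: (@continuous_fcomp _ _ _ fst) => // z; exact: cvg_fst.
transitivity (mean (fun x => mean (fun z => p (x - z) * f z * g x))).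
  congr mean; apply/funext => x; rewrite mulrC -meanZ//; last by cont.
  by congr mean; apply/funext => z; rewrite mulrC.
transitivity (mean (fun z => mean (fun x => p (x - z) * f z * g x))).
  exact: (@mean_exchange _ _ cG (fun x z => p (x - z) * f z * g x) c).
congr mean; apply/funext => z; rewrite -meanZ//; last by cont.
by congr mean; apply/funext => x; rewrite -ep opprB; ring.
Qed.

Lemma conv_bound g (M N : R) : continuous g -> (forall x, `|p x| <= M) ->
  (forall x, `|g x| <= N) -> forall x, `|conv g x| <= M * N.
Proof.
move=> cg pM gN x; apply: mean_norm_le => //; first by cont.
by move=> z; rewrite normrM ler_pM.
Qed.

(** The modulus of continuity of a convolution depends on the second factor only through its bound;
    all equicontinuity below comes from here. *)
Lemma conv_modulus g (N m : R) x y : continuous g -> (forall x, `|g x| <= N) ->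
  (forall z, `|p (x - z) - p (y - z)| <= m) ->
  `|conv g x - conv g y| <= N * m.
Proof.
move=> cg gN pm; apply: mean_dist2 => //; [by cont..|].
by move=> z; rewrite -mulrBl normrM mulrC ler_pM.
Qed.

End Convolution.

(** * D'Alembert's equation on a compact group *)

Section PositiveDefinite.
Variables (R : realType) (G : topologicalZmodType).
Implicit Types u v : G -> R.

(** A finite family is a list of pairs (coefficient, point). Real coefficients do not detect the odd
    part of [u], so evenness is always stated separately. *)
Definition posdef u := forall s : seq (R * G),
  0 <= \sum_(i <- s) \sum_(j <- s) i.1 * j.1 * u (i.2 - j.2).

Lemma posdef_le u x : posdef u -> even_function u -> `|u x| <= u 0.
Proof.
move=> pu eu; rewrite ler_norml; apply/andP; split.
  have := pu [:: (1, 0); (1, x)].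
  by rewrite !big_cons !big_nil /= !subrr subr0 sub0r eu; lra.
have := pu [:: (1, 0); (-1, x)].
by rewrite !big_cons !big_nil /= !subrr subr0 sub0r eu; lra.
Qed.

Lemma posdefZ c u : 0 <= c -> posdef u -> posdef (fun x => c * u x).
Proof.
move=> c0 pu s.
rewrite (_ : \sum_(i <- s) _ =
    c * \sum_(i <- s) \sum_(j <- s) i.1 * j.1 * u (i.2 - j.2)); first exact: mulr_ge0.
rewrite mulr_sumr; apply: eq_bigr => i _; rewrite mulr_sumr.
by apply: eq_bigr => j _; rewrite mulrCA.
Qed.

(** The quadratic form of an autocorrelation is the squared norm of the combination of translates of
    [u] with the given coefficients. *)
Lemma posdef_sp (cG : compact [set: G]) u : continuous u ->
  posdef (fun x => inner u (fun z => u (z - x))).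
Proof.
move=> cu s.
have E x y : inner u (fun z => u (z - (x - y))) = inner (fun z => u (z - x)) (fun z => u (z - y)).
  rewrite innerC {1}/inner -(mean_shift cG (- y)); last by cont.
  by congr mean; apply/funext => z; congr (u _ * _); rewrite opprB addrA addrNK.
rewrite (_ : \sum_(i <- s) _ =
  inner (fun z => \sum_(i <- s) i.1 * u (z - i.2)) (fun z => \sum_(i <- s) i.1 * u (z - i.2))).
  by apply: inner_ge0 => //; apply: continuous_sumf => i; cont.
rewrite /inner (_ : (fun x => _) = fun x =>
    \sum_(i <- s) \sum_(j <- s) (i.1 * u (x - i.2)) * (j.1 * u (x - j.2))); last first.
  by apply/funext => x; rewrite mulr_suml; apply: eq_bigr => i _; rewrite mulr_sumr.
rewrite mean_sum//; last by move=> i; apply: continuous_sumf => j; cont.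
apply: eq_bigr => i _; rewrite mean_sum//; last by move=> j; cont.
apply: eq_bigr => j _; rewrite [mean (fun x => u x * _)](E i.2 j.2) -meanZ//; last by cont.
by congr mean; apply/funext => x; rewrite mulrACA.
Qed.

(* Applying positive definiteness to the doubled family
   [sum_i c_i (delta_(x_i) +- delta_(x_i + a))]. *)
Lemma posdef_dalembert (sg : R) a u : sg ^+ 2 = 1 -> posdef u ->
  posdef (fun x => u x + sg * ((u (x + a) + u (x - a)) / 2)).
Proof.
move=> sg1 pu s.
have := pu (s ++ [seq (sg * i.1, i.2 + a) | i <- s]).
rewrite big_cat /= big_map.
under eq_bigr do rewrite big_cat /= big_map.
under [X in _ + X]eq_bigr do rewrite big_cat /= big_map.
rewrite -!big_split /= => H.
rewrite -(pmulr_rge0 _ (ltr0n R 2)); apply: le_trans H _.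
rewrite le_eqVlt; apply/orP; left; apply/eqP.
rewrite mulr_sumr; apply: eq_bigr => i _; rewrite mulr_sumr -!big_split /=.
apply: eq_bigr => j _.
have -> : i.2 + a - (j.2 + a) = i.2 - j.2 by rewrite opprD addrACA subrr addr0.
have -> : i.2 - (j.2 + a) = i.2 - j.2 - a by rewrite opprD addrA.
rewrite (addrAC i.2 a).
have -> : sg * i.1 * (sg * j.1) = i.1 * j.1 by rewrite mulrACA -expr2 sg1 mul1r.
by field.
Qed.

Variables (p : G -> R) (C : R).
Hypotheses (cG : compact [set: G]) (cp : continuous p) (C0 : 0 <= C).

(** A modulus of continuity measured by that of the kernel [p]. Each instance is a closed condition
    on two values of [u], so it survives pointwise limits. *)
Definition equibounded u := forall x y m,
  (forall z, `|p (x - z) - p (y - z)| <= m) -> `|u x - u y| <= C * m.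

Record normalized u : Prop := Normalized {
  norm_even : even_function u;
  norm_posdef : posdef u;
  norm_at0 : u 0 = 1;
  norm_equi : equibounded u }.

Lemma equibounded_near (e : R) : 0 < e -> \forall t \near (0 : G),
  forall u, equibounded u -> forall x, `|u (x + t) - u x| <= e.
Proof.
move=> e0; have d0 : 0 < e / (C + 1) by rewrite divr_gt0// ltr_wpDl.
apply: filterS (uniformly_continuous cG cp d0) => t H u eu x.
apply: (@le_trans _ _ (C * (e / (C + 1)))).
  by apply: eu => z; rewrite addrAC ltW.
by rewrite mulrCA ler_piMr ?(ltW e0)// ler_pdivrMr ?ltr_wpDl// mul1r lerDl ler01.
Qed.

Lemma equibounded_continuous u : equibounded u -> continuous u.
Proof.
move=> eu x; apply/cvgrPdist_le => e e0.
apply: filterS (nbhs_addr x (equibounded_near e0)) => y /(_ u eu x).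
by rewrite (addrC x) subrK distrC.
Qed.

Local Notation ptws := (prod_topology (fun _ : G => R)).

Lemma continuous_eval (x : G) : continuous (fun f : ptws => f x).
Proof. exact: (@proj_continuous G (fun _ => R) x). Qed.

Lemma cluster_pointwise (u : nat -> G -> R) (v : ptws) (phi : ptws -> R) :
  cluster ((u : nat -> ptws) @ \oo) v -> continuous phi ->
  (forall n, 0 <= phi (u n)) -> 0 <= phi v.
Proof.
move=> clv cphi up; rewrite leNgt; apply/negP => pv.
have nv : nbhs v [set f | phi f < 0].
  have /cvgr_lt/(_ _ pv) := cphi v.
  by [].
have [|f [[n <-]]] := clv [set f | exists n, u n = f] _ _ nv.
  by exists 0%N => // n _; exists n.
by rewrite /= ltNge up.
Qed.

(** An Arzela-Ascoli argument: Tychonoff's theorem gives a pointwise cluster point, and the common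
    modulus of continuity turns closeness on a finite net into uniform closeness. A cluster point is
    approached past every [N], which suffices, so no subsequence is extracted. *)
Lemma normalized_sequence_cluster (u : nat -> G -> R) :
  (forall n, normalized (u n)) ->
  exists2 v, normalized v &
    forall (e : R) N, 0 < e -> exists2 n, (N <= n)%N & forall x, `|u n x - v x| <= e.
Proof.
move=> nu.
have cK := @tychonoff G (fun _ => R) (fun _ => `[-1, 1]%classic)
  (fun _ => @segment_compact R (-1) 1).
have [v clv] : exists v : ptws, cluster ((u : nat -> ptws) @ \oo) v.
  have [|v [_ clv]] := cK ((u : nat -> ptws) @ \oo) _; last by exists v.
  exists 0%N => // n _ x /=; rewrite in_itv /= -ler_norml.
  by have [e1 p1 <- _] := nu n; exact: posdef_le.
have cl phi := @cluster_pointwise u v phi clv.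
have nv : normalized v.
  split.
  - move=> x; apply/eqP; rewrite eq_le -!(subr_ge0 (v _)); apply/andP; split;
      [apply: (cl (fun f => f x - f (- x)))|apply: (cl (fun f => f (- x) - f x))];
      try (by apply: continuous_subf; exact: continuous_eval);
      by move=> n; rewrite (norm_even (nu n)) subrr.
  - move=> s; apply: (cl (fun f => \sum_(i <- s) \sum_(j <- s) i.1 * j.1 * f (i.2 - j.2))).
      apply: continuous_sumf => i; apply: continuous_sumf => j.
      by apply: continuous_mulf; [exact: continuous_cst|exact: continuous_eval].
    by move=> n; exact: (norm_posdef (nu n)).
  - apply/eqP; rewrite eq_le; apply/andP; split; rewrite -subr_ge0.
      apply: (cl (fun f => 1 - f 0)); last by move=> n; rewrite (norm_at0 (nu n)) subrr.
      by apply: continuous_subf; [exact: continuous_cst|exact: continuous_eval].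
    apply: (cl (fun f => f 0 - 1)); last by move=> n; rewrite (norm_at0 (nu n)) subrr.
    by apply: continuous_subf; [exact: continuous_eval|exact: continuous_cst].
  - move=> x y m H; rewrite -subr_ge0.
    apply: (cl (fun f => C * m - `|f x - f y|)).
      apply: continuous_subf; first exact: continuous_cst.
      have c : continuous (fun f : ptws => f x - f y).
        by apply: continuous_subf; exact: continuous_eval.
      exact: continuous_normf c.
    by move=> n; rewrite subr_ge0; exact: (norm_equi (nu n)).
exists v => // e N e0; have e3 : 0 < e / 3 by lra.
have [b|l Hl] := @compact_finite_net G
    (fun b x => forall w, equibounded w -> `|w x - w b| <= e / 3) cG _.
  apply: filterS (nbhs_addr b (equibounded_near e3)) => x H w ew.
  by have := H w ew b; rewrite (addrC b) subrK.
have nl : nbhs v [set f : ptws | forall b, b \in l -> `|f b - v b| < e / 3].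
  elim: l {Hl} => [|a l IH]; first by apply: filterS (@filterT _ (nbhs v) _) => f _ b.
  have na : nbhs v [set f : ptws | `|f a - v a| < e / 3].
    have c : continuous (fun f : ptws => f a - v a).
      by apply: continuous_subf; [exact: continuous_eval|exact: continuous_cst].
    have := @continuous_normf R ptws _ c v.
    by rewrite /continuous_at subrr normr0 => /cvgr_lt/(_ _ e3).
  apply: filterS (filterI na IH) => f [fa fl] b; rewrite inE => /orP[/eqP ->//|].
  exact: fl.
have [|f [[n Nn <-] fl]] := clv [set f | exists2 n, (N <= n)%N & u n = f] _ _ nl.
  by exists N => // n /= Nn; exists n.
exists n => // x; have [b bl H] := Hl x.
have := fl b bl; have := H _ (norm_equi (nu n)); have := H _ (norm_equi nv).
by rewrite ltr_norml !ler_norml; lra.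
Qed.

End PositiveDefinite.

(** * An eigenfunction by power iteration *)

Section PowerIteration.
Variables (R : realType) (G : topologicalZmodType).
Hypothesis cG : compact [set: G].
Variables (p : G -> R) (M : R).
Hypotheses (cp : continuous p) (ep : even_function p) (p0 : p 0 != 0).
Hypotheses (M0 : 0 < M) (pM : forall x, `|p x| <= M).
Local Notation L := (conv p).
Let P n := iter n L p.

Let PS n : P n.+1 = L (P n). Proof. by []. Qed.

Let cP n : continuous (P n).
Proof. by elim: n => // n IH; rewrite PS; exact: continuous_conv. Qed.

Let eP n : even_function (P n).
Proof. by elim: n => // n IH; rewrite PS; exact: conv_even. Qed.

Let inner_iter m n : inner (P m) (P n) = inner p (P (m + n)).
Proof.
elim: m n => [//|m IH] n.
by rewrite PS conv_selfadjoint// -PS IH addnS.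
Qed.

(** For [m = n] this exhibits an odd iterate as the autocorrelation of [P n]; hence [r n] is
    positive definite, with value [c n] at 0. *)
Let iter_conv_val m n x :
  P (m + n).+1 x = inner (P m) (fun z => P n (z - x)).
Proof.
elim: m n => [|m IH] n.
  rewrite add0n -(eP n.+1) PS /conv /inner -(mean_shift cG (- x)); last first.
    exact: (continuous_mulf (continuous_subl (a := - x) cp) (@cP n)).
  congr mean; apply/funext => z; congr (_ * _).
  by rewrite opprB addrA addNr sub0r ep.
rewrite addSnnS IH PS conv_selfadjoint//.
  by rewrite (conv_shift cG cp).
by apply: continuous_shift; exact: (@cP n).
Qed.

Let c n := inner (P n) (P n).
Let r n := P (n + n).+1.

Let cr n : continuous (r n). Proof. exact: cP. Qed.

Let inner_P m n : inner (P m) (P (m + n.*2)) = c (m + n).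
Proof. by rewrite /c !inner_iter; congr (inner p (P _)); rewrite -addnn; lia. Qed.

Let r_pd n : posdef (r n).
Proof.
have -> : r n = fun x => inner (P n) (fun z => P n (z - x)).
  by apply/funext => x; exact: iter_conv_val.
by apply: posdef_sp => //; exact: (@cP n).
Qed.

Let r0 n : r n 0 = c n.
Proof.
rewrite /r iter_conv_val /c; congr inner; apply/funext => z; by rewrite subr0.
Qed.

Let rS n : L (L (r n)) = r n.+1.
Proof. by rewrite /r addSn addnS. Qed.

Let inner_r m n : inner (r m) (r n) = c (m + n).+1.
Proof. by rewrite /r /c !inner_iter; congr (inner p (P _)); lia. Qed.

Let c_ge0 n : 0 <= c n. Proof. by apply: inner_ge0 => //; exact: cP. Qed.

Let inner_gt0 (f : G -> R) x : continuous f -> f x != 0 -> 0 < inner f f.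
Proof.
move=> cf; apply: contraNT; rewrite -leNgt => ff.
by rewrite (inner_eq0 cG cf ff x).
Qed.

(** [p 0 != 0] gives the first value, [L p 0 = inner p p] the second, and log-convexity of [c]
    propagates positivity. *)
Let c_gt0 n : 0 < c n.
Proof.
have c0 : 0 < c 0 by exact: (@inner_gt0 _ 0).
have c1 : 0 < c 1.
  apply: (@inner_gt0 _ 0); first exact: (@cP 1).
  rewrite PS (_ : L (P 0) 0 = c 0) ?gt_eqF//.
  by congr mean; apply/funext => z; rewrite sub0r ep.
suff [] : 0 < c n /\ 0 < c n.+1 by [].
elim: n => [//|n [cn cn1]]; split => //.
have := inner_CS cG (@cP n) (@cP n.+2).
have -> : inner (P n) (P n.+2) = c n.+1 by rewrite -addn2 (inner_P n 1) addn1.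
move=> h; have : 0 < c n * c n.+2 by apply: lt_le_trans h; rewrite exprn_gt0.
by rewrite pmulr_rgt0.
Qed.

Let rho n := c n.+1 / c n.

Let rho_gt0 n : 0 < rho n. Proof. exact: divr_gt0. Qed.

Let cE n : c n.+1 = rho n * c n.
Proof. by rewrite /rho divfK// gt_eqF. Qed.

(** Cauchy-Schwarz for [P n] and [P n.+2], whose inner product is [c n.+1] by self-adjointness. *)
Let rhoS n : rho n <= rho n.+1.
Proof.
rewrite /rho ler_pdivrMr// mulrAC ler_pdivlMr//.
have := inner_CS cG (@cP n) (@cP n.+2).
have -> : inner (P n) (P n.+2) = c n.+1 by rewrite -addn2 (inner_P n 1) addn1.
by rewrite expr2 -/(c n) -/(c n.+2) (mulrC (c n)).
Qed.

Let rho_le n m : (n <= m)%N -> rho n <= rho m.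
Proof.
move=> /subnKC <-; elim: (m - n)%N => [|k IH]; first by rewrite addn0.
by rewrite addnS; apply: le_trans IH _.
Qed.

Let r_le n x : `|r n x| <= c n.
Proof. by rewrite -r0; apply: posdef_le; [exact: r_pd|exact: eP]. Qed.

Let rho_ub n : rho n <= M * M.
Proof.
rewrite /rho ler_pdivrMr// -r0 -rS; apply: ler_normlW.
rewrite -mulrA; apply: conv_bound => //; first by apply: continuous_conv => //; exact: cr.
exact: conv_bound.
Qed.

Let lam := sup (range rho).

Let has_sup_rho : has_sup (range rho).
Proof. by split; [exists (rho 0), 0%N|exists (M * M) => _ [n _ <-]]. Qed.

Let rho_lam n : rho n <= lam.
Proof. by apply: sup_upper_bound => //; exists n. Qed.

Let lam_gt0 : 0 < lam. Proof. exact: lt_le_trans (rho_gt0 0) (rho_lam 0). Qed.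

Definition eigendefect l (f : G -> R) : G -> R := fun x => L (L f) x - l * f x.

Lemma continuous_eigendefect (l : R) (f : G -> R) : continuous f -> continuous (eigendefect l f).
Proof.
move=> cf; apply: continuous_subf; last by cont.
by do 2 apply: continuous_conv => //.
Qed.

Lemma eigendefect_close (l : R) (f g : G -> R) (e : R) : 0 <= l -> continuous f -> continuous g ->
  (forall x, `|f x - g x| <= e) ->
  forall x, `|eigendefect l f x - eigendefect l g x| <= (M * M + l) * e.
Proof.
move=> l0 cf cg fg x.
have cLf : continuous (L f) by exact: continuous_conv.
have cLg : continuous (L g) by exact: continuous_conv.
have cfg : continuous (fun x => f x + -1 * g x) by cont.
have E : L (L f) x - L (L g) x = L (L (fun x => f x + -1 * g x)) x.
  have cg1 : continuous (fun x => -1 * g x) by cont.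
  have cLg1 : continuous (fun x => -1 * L g x) by cont.
  by rewrite convD// (convZ cG cp _ cg) convD// (convZ cG cp _ cLg) mulN1r.
have -> : eigendefect l f x - eigendefect l g x =
    L (L (fun x => f x + -1 * g x)) x - l * (f x - g x).
  by rewrite -E /eigendefect; ring.
apply: le_trans (ler_normB _ _) _; rewrite mulrDl lerD//.
  rewrite -mulrA; apply: conv_bound => //; first exact: continuous_conv.
  by apply: conv_bound => // y; rewrite mulN1r.
by rewrite normrM ger0_norm// ler_wpM2l.
Qed.

Let u n : G -> R := fun x => (c n)^-1 * r n x.

Let cu n : continuous (u n).
Proof. by apply: continuous_mulf; [exact: continuous_cst|exact: cr]. Qed.

Let u_le n x : `|u n x| <= 1.
Proof.
rewrite /u normrM gtr0_norm ?invr_gt0// mulrC ler_pdivrMr// mul1r.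
exact: r_le.
Qed.

(** The index is shifted because [u n.+1] is a convolution: its second factor
    [(c n.+1)^-1 * L (r n)] is bounded by [M / rho n], and [rho 0] is the smallest ratio. *)
Let u_normalized n : normalized p (M / rho 0) (u n.+1).
Proof.
split.
- by move=> x; rewrite /u; congr (_ * _); exact: eP.
- by apply: posdefZ; [rewrite invr_ge0|exact: r_pd].
- by rewrite /u r0 mulVf// gt_eqF.
move=> x y m H.
have m0 : 0 <= m by apply: le_trans (H 0).
have cLr : continuous (L (r n)) by apply: continuous_conv => //; exact: cr.
have -> : u n.+1 = L (fun x => (c n.+1)^-1 * L (r n) x).
  by rewrite (convZ cG cp _ cLr) rS.
apply: conv_modulus => //; first by cont.
move=> z; rewrite normrM gtr0_norm ?invr_gt0// mulrC.
rewrite ler_pdivrMr// cE.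
apply: (@le_trans _ _ (M * c n)).
  exact: conv_bound.
apply: (@le_trans _ _ (M / rho 0 * (rho 0 * c n))).
  by rewrite mulrA divfK// gt_eqF.
rewrite ler_wpM2l//; first by rewrite divr_ge0 ?ltW.
by rewrite ler_wpM2r// rho_le.
Qed.

(** The squared norm expands to a factor at most 1 times [r1 * r2 - 2 * lam * r1 + lam ^+ 2], where
    [r1] and [r2] are consecutive ratios. Since [r2 <= lam], this is at most [lam * (lam - r1)],
    which is small once [r1] is near its supremum. *)
Let defect_small (e : R) : 0 < e -> exists N, forall n, (N <= n)%N ->
  inner (eigendefect lam (u n)) (eigendefect lam (u n)) <= e.
Proof.
move=> e0; have d0 : 0 < e / lam by exact: divr_gt0.
have [_ [N _ <-] rhoN] := sup_adherent d0 has_sup_rho.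
exists N => n Nn.
have -> : eigendefect lam (u n) =
    fun x => (c n)^-1 * r n.+1 x + (- lam / c n) * r n x.
  have cLr : continuous (L (r n)) by apply: continuous_conv => //; exact: cr.
  apply/funext => x; rewrite /eigendefect /u (convZ cG cp _ (@cr n)).
  by rewrite (convZ cG cp _ cLr) rS; ring.
rewrite inner_expand//; [|exact: cr..].
rewrite !inner_r !addSn !addnS (cE (n + n).+2) (cE (n + n).+1).
have us : c (n + n).+1 / c n ^+ 2 <= 1.
  have -> : c (n + n).+1 / c n ^+ 2 = inner (u n) (u n).
    rewrite /u (innerZl cG _ (@cr n) (@cu n)) (innerZr cG _ (@cr n) (@cr n)) inner_r.
    by rewrite expr2 invfM; ring.
  apply: ler_normlW; apply: mean_norm_le => //; first by apply: continuous_mulf; exact: cu.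
  by move=> x; rewrite normrM; apply: mulr_ile1.
have us0 : 0 <= c (n + n).+1 / c n ^+ 2 by rewrite divr_ge0// exprn_ge0.
set s := c (n + n).+1 in us us0 *; set k := c n in us us0 *.
set r1 := rho (n + n).+1; set r2 := rho (n + n).+2.
have l1 : r1 <= lam by exact: rho_lam.
have l2 : r2 <= lam by exact: rho_lam.
have l3 : lam - e / lam < r1 by apply: lt_le_trans rhoN _; apply: rho_le; lia.
have h : lam * (lam - r1) <= e.
  have : lam - r1 <= e / lam by lra.
  by rewrite ler_pdivlMr// mulrC.
have kn : k != 0 by rewrite gt_eqF// c_gt0.
apply: (@le_trans _ _ (s / k ^+ 2 * (r1 * r2 - 2 * lam * r1 + lam ^+ 2))).
  rewrite le_eqVlt; apply/orP; left; apply/eqP; field; exact: kn.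
have h2 : r1 * r2 - 2 * lam * r1 + lam ^+ 2 <= e.
  have : r1 * r2 <= r1 * lam by rewrite ler_wpM2l// ltW// rho_gt0.
  lra.
have [q0|q0] := leP 0 (r1 * r2 - 2 * lam * r1 + lam ^+ 2).
  by apply: le_trans h2; rewrite ler_piMl.
by apply: (@le_trans _ _ 0); [rewrite mulr_ge0_le0// ltW|exact: ltW].
Qed.

Lemma eigenfunction_exists : exists (l : R) (v : G -> R),
  [/\ 0 < l, continuous v, even_function v, posdef v & v 0 = 1 /\ forall x, L (L v) x = l * v x].
Proof.
have C0 : 0 <= M / rho 0 by rewrite divr_ge0// ltW.
have [v nv vP] := normalized_sequence_cluster cG cp C0 (fun n => u_normalized n).
have cv : continuous v := equibounded_continuous cG cp C0 (norm_equi nv).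
exists lam, v; split => //; [exact: norm_even nv|exact: norm_posdef nv|].
split; first exact: norm_at0 nv.
suff H : inner (eigendefect lam v) (eigendefect lam v) <= 0.
  move=> x; apply/eqP; rewrite -subr_eq0; apply/eqP.
  exact: (inner_eq0 cG (continuous_eigendefect cv) H x).
apply/ler_addgt0Pl => e e0; rewrite addr0.
have e4 : 0 < e / 4 by lra.
have [N HN] := defect_small e4.
pose K := M * M + lam.
have K0 : 0 < K by rewrite addr_gt0// mulr_gt0.
(* [K] is a Lipschitz constant of the defect for the uniform distance; the minimum with 1 makes the
   square of the resulting distance at most [e / 4]. *)
pose d := Num.min 1 (e / 4) / K.
have d0 : 0 < d by rewrite divr_gt0// lt_min ltr01.
have [n Nn un] := vP d N d0.
have := HN n.+1 (leqW Nn).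
set f := eigendefect lam (u n.+1); set g := eigendefect lam v => ff.
have cf : continuous f by apply: continuous_eigendefect; exact: cu.
have cg : continuous g by apply: continuous_eigendefect.
have fg x : `|f x - g x| <= Num.min 1 (e / 4).
  have := @eigendefect_close lam _ _ d (ltW lam_gt0) (@cu n.+1) cv un x.
  by rewrite -/K /d mulrC divfK// gt_eqF.
(* From [g ^+ 2 <= 2 * f ^+ 2 + 2 * (f - g) ^+ 2], whose two sides differ by [(2 * f - g) ^+ 2]. *)
apply: (@le_trans _ _ (mean (fun x => 2 * (f x * f x) + 2 * (e / 4)))).
  apply: mean_le => //; [by cont|by cont|move=> x].
  have := fg x; rewrite le_min => /andP[h1 h2].
  have h3 : (f x - g x) ^+ 2 <= e / 4.
    by rewrite -real_normK ?num_real// -[e / 4]mul1r expr2; exact: ler_pM.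
  have : 0 <= (2 * f x - g x) ^+ 2 by exact: sqr_ge0.
  move: h3; rewrite !expr2; lra.
rewrite meanD//; [|by cont..].
rewrite meanZ//; last by cont.
rewrite (_ : mean (fun _ : G => 2 * (e / 4)) = 2 * (e / 4)); last exact: mean_cst.
move: ff; rewrite /inner; lra.
Qed.

End PowerIteration.

(** * An extremal eigenfunction satisfies d'Alembert's equation *)

Section ExtremalEigenfunction.
Variables (R : realType) (G : topologicalZmodType).
Hypothesis cG : compact [set: G].
Variables (p : G -> R) (M l : R).
Hypotheses (cp : continuous p) (ep : even_function p).
Hypotheses (M0 : 0 < M) (pM : forall x, `|p x| <= M) (l0 : 0 < l).
Local Notation L := (conv p).
Implicit Types v w : G -> R.

Record eigenfunction v : Prop := Eigenfunction {
  eigen_continuous : continuous v;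
  eigen_even : even_function v;
  eigen_posdef : posdef v;
  eigen_at0 : v 0 = 1;
  eigen_eq : forall x, L (L v) x = l * v x }.

Lemma eigen_le1 v : eigenfunction v -> forall x, `|v x| <= 1.
Proof.
by move=> ev x; rewrite -(eigen_at0 ev); apply: posdef_le;
  [exact: eigen_posdef|exact: eigen_even].
Qed.

(** [v] is the convolution of [p] with [l^-1 * L v], which is bounded by [M / l]. All eigenfunctions
    for [l] thus share one modulus of continuity, so a maximising sequence has a uniform cluster
    point. *)
Lemma eigen_normalized v : eigenfunction v -> normalized p (M / l) v.
Proof.
move=> ev; split; [exact: eigen_even|exact: eigen_posdef|exact: eigen_at0|].
have cv := eigen_continuous ev.
have cLv : continuous (L v) by exact: continuous_conv.
move=> x y m H.
have -> : v = L (fun x => l^-1 * L v x).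
  apply/funext => z; rewrite (convZ cG cp _ cLv) (eigen_eq ev) mulrA mulVf ?mul1r//.
  by rewrite gt_eqF.
apply: conv_modulus => //; first by cont.
move=> z; rewrite normrM gtr0_norm ?invr_gt0// mulrC ler_wpM2r//.
  by rewrite invr_ge0 ltW.
by rewrite -[M]mulr1; apply: conv_bound => //; exact: eigen_le1.
Qed.

Lemma inner_close v w (e : R) : 0 <= e -> continuous v -> continuous w ->
  (forall x, `|v x| <= 1) -> (forall x, `|w x| <= 1) ->
  (forall x, `|v x - w x| <= e) -> `|inner v v - inner w w| <= 2 * e.
Proof.
move=> e0 cv cw v1 w1 vw; apply: mean_dist2 => //; [by cont..|move=> x].
have -> : v x * v x - w x * w x = (v x + w x) * (v x - w x) by ring.
rewrite normrM; apply: ler_pM => //.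
by apply: le_trans (ler_normD _ _) _; have := v1 x; have := w1 x; lra.
Qed.

Lemma maximal_eigenfunction v0 : eigenfunction v0 ->
  exists2 v, eigenfunction v & forall w, eigenfunction w -> inner w w <= inner v v.
Proof.
move=> ev0.
pose A := [set inner v v | v in [set v | eigenfunction v]].
have hA : has_sup A.
  split; first by exists (inner v0 v0), v0.
  exists 1 => _ [v ev <-]; apply: ler_normlW; apply: mean_norm_le => //.
    by have cv := eigen_continuous ev; cont.
  by move=> x; rewrite normrM mulr_ile1//; exact: eigen_le1.
have /choice[u uP] : forall n : nat, exists v,
    eigenfunction v /\ sup A - n.+1%:R^-1 < inner v v.
  move=> n; have n0 : 0 < n.+1%:R^-1 :> R by rewrite invr_gt0.
  by have [_ [v ev <-] vn] := sup_adherent n0 hA; exists v.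
have C0 : 0 <= M / l by rewrite divr_ge0// ltW.
have [v nv vP] := normalized_sequence_cluster cG cp C0
  (fun n => eigen_normalized (uP n).1).
have cv : continuous v := equibounded_continuous cG cp C0 (norm_equi nv).
have v1 x : `|v x| <= 1.
  by rewrite -(norm_at0 nv); apply: posdef_le; [exact: norm_posdef nv|exact: norm_even nv].
exists v.
  split => //; [exact: norm_even nv|exact: norm_posdef nv|exact: norm_at0 nv|].
  move=> x; apply/eqP; rewrite -subr_eq0 -normr_le0; apply/ler_addgt0Pl => e e0.
  rewrite addr0.
  have K0 : 0 < M * M + l by rewrite addr_gt0// mulr_gt0.
  have d0 : 0 < e / (M * M + l) by exact: divr_gt0.
  have [n _ un] := vP _ 0%N d0.
  have eu := (uP n).1.
  have := @eigendefect_close _ _ cG p M cp pM l _ _ _ (ltW l0)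
    (@eigen_continuous _ eu) cv un x.
  by rewrite /eigendefect (eigen_eq eu) subrr sub0r normrN (mulrC (M * M + l)) divfK// gt_eqF.
move=> w ew.
apply: (@le_trans _ _ (sup A)); first by apply: sup_upper_bound => //; exists w.
apply/ler_addgt0Pl => e e0; have e4 : 0 < e / 4 by lra.
have [N HN] : exists N : nat, forall n, (N <= n)%N -> n.+1%:R^-1 <= e / 2.
  exists (Num.trunc (2 / e)) => n Nn.
  rewrite -[leRHS]invrK lef_pV2 ?posrE ?invr_gt0 ?divr_gt0//.
  rewrite invf_div ltW//; have := truncnS_gt (2 / e) => /lt_le_trans; apply.
  by rewrite ler_nat ltnS.
have [n Nn un] := vP _ N e4.
have [eu un'] := uP n.
have := inner_close (ltW e4) (eigen_continuous eu) cv (eigen_le1 eu) v1 un.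
have := HN n Nn; move: un'; set q := _^-1; rewrite ler_norml; lra.
Qed.

(* Maximality of [inner v v] makes [v] an extreme point, so that the decomposition
   of [v] into its halves [v +- (v (. + a) + v (. - a)) / 2] is trivial. *)
Lemma maximal_eigenfunction_dalembert v : eigenfunction v ->
  (forall w, eigenfunction w -> inner w w <= inner v v) ->
  forall a x, v (x + a) + v (x - a) = 2 * v a * v x.
Proof.
move=> ev vmax a.
have cv := eigen_continuous ev.
pose h (sg : R) : G -> R := fun x => v x + sg * ((v (x + a) + v (x - a)) / 2).
have ch sg : continuous (h sg) by rewrite /h; cont.
have eh sg : even_function (h sg).
  move=> x; have -> : h sg (- x) = v (- x) + sg * ((v (- x + a) + v (- x - a)) / 2) by [].
  have -> : - x + a = - (x - a) by rewrite opprB addrC.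
  by rewrite -opprD !(eigen_even ev) (addrC (v (x - a))).
have ph sg : sg ^+ 2 = 1 -> posdef (h sg).
  by move=> sg1; apply: posdef_dalembert => //; exact: eigen_posdef.
have h0 sg : h sg 0 = 1 + sg * v a.
  rewrite /h (eigen_at0 ev) add0r sub0r (eigen_even ev); congr (_ + _ * _).
  by field.
have cL f : continuous f -> continuous (L f) by exact: continuous_conv.
have csa b : continuous (fun x => v (x + b)) by cont.
have Lh sg x : L (L (h sg)) x = l * h sg x.
  have E : h sg = fun x => v x + (sg / 2) * (v (x + a) + v (x + - a)).
    by apply/funext => y; rewrite /h; ring.
  have c1 : continuous (fun x => v (x + a) + v (x - a)) by cont.
  have c2 : continuous (fun x => sg / 2 * (v (x + a) + v (x - a))) by cont.
  have LE f g : continuous f -> continuous g ->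
      L (fun x => f x + sg / 2 * (g (x + a) + g (x - a))) =
      fun x => L f x + sg / 2 * (L g (x + a) + L g (x - a)).
    move=> cf cg.
    have ca : continuous (fun x => g (x + a)) by cont.
    have cb : continuous (fun x => g (x + - a)) by cont.
    have cab : continuous (fun x => g (x + a) + g (x + - a)) by cont.
    have cc : continuous (fun x => sg / 2 * (g (x + a) + g (x + - a))) by cont.
    by rewrite (convD cG cp cf cc) (convZ cG cp _ cab) (convD cG cp ca cb)
      !(conv_shift cG cp _ cg).
  rewrite E LE// LE//; [|exact: cL..].
  by rewrite !(eigen_eq ev); ring.
have eigh sg : sg ^+ 2 = 1 -> 0 < 1 + sg * v a ->
    eigenfunction (fun x => (1 + sg * v a)^-1 * h sg x).
  move=> sg1 t0; split.
  - by have := ch sg => chs; cont.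
  - by move=> x; rewrite eh.
  - by apply: posdefZ; [rewrite invr_ge0 ltW|exact: ph].
  - by rewrite h0 mulVf// gt_eqF.
  move=> x; rewrite (convZ cG cp _ (@ch sg)) (convZ cG cp _ (@cL _ (@ch sg))) Lh.
  by rewrite mulrCA.
have va1 := eigen_le1 ev a; rewrite ler_norml in va1.
have sg1 : (1 : R) ^+ 2 = 1 by rewrite expr1n.
have sgN1 : (-1 : R) ^+ 2 = 1 by rewrite sqrrN expr1n.
have hz sg : sg ^+ 2 = 1 -> 1 + sg * v a = 0 -> forall x, h sg x = 0.
  move=> sgE z x; apply/eqP; rewrite -normr_le0 -z -h0.
  by apply: posdef_le; [exact: ph|exact: eh].
(* In the two degenerate cases one half [h (-1)] or [h 1] is 0 at the origin, hence everywhere by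
   positive definiteness, and its vanishing is the equation itself. *)
have [va|va] := eqVneq (v a) 1.
  move=> x; have := hz (-1) sgN1 _ x; rewrite va /h => /(_ ltac:(lra)); lra.
have [va'|va'] := eqVneq (v a) (-1).
  move=> x; have := hz 1 sg1 _ x; rewrite va' /h => /(_ ltac:(lra)); lra.
have t1 : 0 < 1 + 1 * v a.
  rewrite mul1r lt_neqAle eq_sym; apply/andP; split; last lra.
  by apply: contra va' => /eqP ?; apply/eqP; lra.
have t2 : 0 < 1 + -1 * v a.
  rewrite mulN1r lt_neqAle eq_sym; apply/andP; split; last lra.
  by apply: contra va => /eqP ?; apply/eqP; lra.
have e1 := eigh _ sg1 t1; have e2 := eigh _ sgN1 t2.
set v1 := (fun x => _) in e1; set v2 := (fun x => _) in e2.
have c1 := eigen_continuous e1; have c2 := eigen_continuous e2.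
have vE : v = fun x => ((1 + v a) / 2) * v1 x + ((1 - v a) / 2) * v2 x.
  apply/funext => x; rewrite /v1 /v2 /h; field.
  by rewrite (gt_eqF t2) /= -[v a]mul1r (gt_eqF t1).
have s12 : inner v v = ((1 + v a) / 2) ^+ 2 * inner v1 v1 +
    2 * ((1 + v a) / 2 * ((1 - v a) / 2)) * inner v1 v2 +
    ((1 - v a) / 2) ^+ 2 * inner v2 v2.
  by rewrite {1 2}vE inner_expand.
pose d : G -> R := fun x => 1 * v1 x + -1 * v2 x.
have dE : inner d d = inner v1 v1 - 2 * inner v1 v2 + inner v2 v2.
  by rewrite /d inner_expand//; ring.
have m1 := vmax _ e1; have m2 := vmax _ e2.
have dd : inner d d <= 0.
  set t := (1 + v a) / 2 in s12.
  have tE : (1 - v a) / 2 = 1 - t by rewrite /t; field.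
  rewrite tE in s12.
  have t0 : 0 < t by rewrite divr_gt0//; lra.
  have t'0 : 0 < 1 - t by rewrite -tE divr_gt0//; lra.
  (* Strict convexity of the squared norm: by maximality both differences on the right are
     nonpositive. *)
  have key : t * (1 - t) * inner d d =
      t * (inner v1 v1 - inner v v) + (1 - t) * (inner v2 v2 - inner v v).
    by rewrite dE s12; ring.
  rewrite -(pmulr_rle0 _ (mulr_gt0 t0 t'0)) key.
  have h1 : t * (inner v1 v1 - inner v v) <= 0 by rewrite pmulr_rle0//; lra.
  have h2 : (1 - t) * (inner v2 v2 - inner v v) <= 0 by rewrite pmulr_rle0//; lra.
  by rewrite -[leRHS]addr0 lerD.
have cd : continuous d by rewrite /d; cont.
have d0 := inner_eq0 cG cd dd.
move=> x; have := d0 x; rewrite /d /v1 /v2 mul1r mulN1r => /eqP.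
rewrite subr_eq0 => /eqP E.
(* The equality [v1 x = v2 x] with denominators cleared; solving it for [v (x + a) + v (x - a)]
   gives the claim. *)
have : (1 + -1 * v a) * h 1 x = (1 + 1 * v a) * h (-1) x.
  have q (A B X : R) : A != 0 -> A * B * (A^-1 * X) = B * X by move=> A0; field.
  have n1 : 1 + 1 * v a != 0 by rewrite gt_eqF.
  have n2 : 1 + -1 * v a != 0 by rewrite gt_eqF.
  have q1 := q _ (1 + -1 * v a) (h 1 x) n1.
  have q2 := q _ (1 + 1 * v a) (h (-1) x) n2.
  by rewrite -q1 E (mulrC (1 + 1 * v a)) q2.
rewrite /h; lra.
Qed.

End ExtremalEigenfunction.

(* A bump function [h] separating [0] from [a], symmetrised to [p], kills every
   solution of d'Alembert's equation with value [1] at [a]. *)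
Lemma dalembert_separates (R : realType) (G : topologicalZmodType) (a : G) :
  hausdorff_space G -> compact [set: G] -> a != 0 ->
  exists v : G -> R, [/\ continuous v, v 0 = 1, even_function v /\ (forall x, `|v x| <= 1),
    (forall y x, v (x + y) + v (x - y) = 2 * v y * v x) & v a != 1].
Proof.
move=> hG cG a0.
have nG := compact_normal hG cG.
have clo x : closed [set x : G] by exact: accessible_closed_set1 (hausdorff_accessible hG) x.
have [|g [cg _ ga g0]] := (iffLR (@uniform_separatorP G R [set a] [set 0])) _.
  apply: (iffLR (@normal_separatorP R G) nG); [exact: clo|exact: clo|].
  by apply/seteqP; split => // x [-> /= e]; move: a0; rewrite e eqxx.
have {}ga : g a = 0 by apply: ga; exists a.
have {}g0 : g 0 = 1 by apply: g0; exists 0.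
(* The product makes the Urysohn function even while keeping the values 1 at 0 and 0 at [a]. *)
pose h x := g x * g (- x).
have ch : continuous h by rewrite /h; cont.
have eh : even_function h by move=> x; rewrite /h opprK mulrC.
have h0 : h 0 = 1 by rewrite /h oppr0 g0 mulr1.
have ha : h a = 0 by rewrite /h ga mul0r.
clearbody h.
pose p x := h x - (h (x + a) + h (x - a)) / 2.
have cp : continuous p by rewrite /p; cont.
have ep : even_function p.
  move=> x; have -> : p (- x) = h (- x) - (h (- x + a) + h (- x - a)) / 2 by [].
  have -> : - x + a = - (x - a) by rewrite opprB addrC.
  by rewrite -opprD !eh (addrC (h (x - a))).
have p0 : p 0 != 0.
  by rewrite /p add0r sub0r eh ha h0 addr0 mul0r subr0 oner_eq0.
have [M M0 pM] := compact_fun_bounded cG cp.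
have [l [v0 [l0 cv0 ev0 pv0 [v00 Lv0]]]] := eigenfunction_exists cG cp ep p0 M0 pM.
have [v ev vmax] := maximal_eigenfunction cG cp M0 pM l0
  (Eigenfunction cv0 ev0 pv0 v00 Lv0).
have dv := maximal_eigenfunction_dalembert cG cp ev vmax.
have cv := eigen_continuous ev.
exists v; split => //; [exact: eigen_at0 ev| |].
  by split; [exact: eigen_even ev|exact: eigen_le1 ev].
apply/eqP => va.
have Lv : conv p v = cst 0.
  apply/funext => x.
  have csh b : continuous (fun z => h (x - z + b) * v z).
    apply: continuous_mulf => //.
    rewrite (_ : (fun z => _) = fun z => h (x + b - z)); first by cont.
    by apply/funext => z; rewrite addrAC.
  (* Invariance of the mean moves the shifts of [h] onto [v]; as [v a = 1], the two shifts of [v]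
     add up to [2 * v] and cancel the main term. *)
  have E b : mean (fun z => h (x - z + b) * v z) = mean (fun z => h (x - z) * v (z + b)).
    rewrite -[LHS](mean_shift cG b)//; congr mean; apply/funext => z.
    by congr (h _ * _); rewrite opprD addrA subrK.
  have cs0 : continuous (fun z => h (x - z) * v z) by cont.
  have cs b : continuous (fun z => h (x - z) * v (z + b)) by cont.
  rewrite /conv (_ : (fun z => _) = fun z => h (x - z) * v z -
      2^-1 * (h (x - z + a) * v z + h (x - z + - a) * v z)); last first.
    by apply/funext => z; rewrite /p; field.
  have ca : continuous (fun z => h (x - z + a) * v z) := @csh a.
  have cna : continuous (fun z => h (x - z + - a) * v z) := @csh (- a).
  have c1 := continuous_addf ca cna.
  have c2 := continuous_mulf (@continuous_cst R G 2^-1) c1.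
  rewrite (meanB cG cs0 c2) (meanZ cG _ c1) (meanD cG ca cna) !E.
  have c3 := continuous_addf (@cs a) (@cs (- a)).
  have c4 := continuous_mulf (@continuous_cst R G 2^-1) c3.
  rewrite -(meanD cG (@cs a) (@cs (- a))) -(meanZ cG _ c3) -(meanB cG cs0 c4).
  rewrite -[RHS](mean_cst G (0 : R)); congr mean; apply/funext => z.
  have := dv a z; rewrite va => dvz.
  have -> : h (x - z) * v (z + a) + h (x - z) * v (z - a) =
    h (x - z) * (v (z + a) + v (z - a)) by ring.
  by rewrite dvz /cst; field.
have := eigen_eq ev 0; rewrite Lv (eigen_at0 ev) mulr1.
rewrite (_ : conv p _ 0 = 0) => [l00|]; first by rewrite -l00 ltxx in l0.
rewrite -[RHS](mean_cst G (0 : R)); congr mean; apply/funext => z.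
by rewrite /cst mulr0.
Qed.

Definition additive_of (U V : zmodType) (f : U -> V) (fB : zmod_morphism f) :
    {additive U -> V} :=
  HB.pack f (GRing.isZmodMorphism.Build U V f fB).

(** * Closed maps from compact spaces *)

Section Compactness.

Lemma compact_to_hausdorff_closed (X Y : topologicalType) (f : X -> Y) (C : set X) :
  compact [set: X] -> hausdorff_space Y -> continuous f -> closed C ->
  closed (f @` C).
Proof.
move=> cX hY cf clC; apply: compact_closed => //.
apply: continuous_compact; first by apply: continuous_subspaceT.
exact: subclosed_compact clC cX (@subsetT _ _).
Qed.

(** An injective continuous map from a compact space to a Hausdorff one is a closed embedding, so
    continuity may be tested after composing with it. *)
Lemma continuous_factor (X K S : topologicalType) (h : K -> S) (f : X -> K) :
  compact [set: K] -> hausdorff_space S -> continuous h -> injective h ->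
  continuous (h \o f) -> continuous f.
Proof.
move=> cK hS ch ih /continuous_closedP chf; apply/continuous_closedP => C clC.
rewrite (_ : f @^-1` C = (h \o f) @^-1` (h @` C)).
  by apply: chf; exact: compact_to_hausdorff_closed.
by apply/seteqP; split=> [x Cx|x [y Cy /ih e]]; [exists (f x)|rewrite /= -e].
Qed.

Lemma compact_locally_compact (X : topologicalType) :
  compact [set: X] -> locally_compact [set: X].
Proof.
move=> cX x _; exists setT; first exact: filterT.
by split; [|exact: closedT].
Qed.

End Compactness.

(** * Quotients, the circle and its characters *)

Section Quotients.
Variables (T : topologicalZmodType) (H : zmodClosed T).
Local Notation Q := (quotient_topology {ideal_quot H}).

Definition qpi (x : T) : Q := \pi_Q%qT x.

Lemma qpi_zmod_morphism : zmod_morphism qpi.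
Proof. by move=> x y; rewrite /qpi [LHS]Quotient.pi_add Quotient.pi_opp. Qed.

HB.instance Definition _ := GRing.isZmodMorphism.Build T Q qpi qpi_zmod_morphism.

Lemma qpi_surj (q : Q) : exists x, qpi x = q.
Proof. by exists (repr q); exact: reprK. Qed.

Lemma qpi_eq x y : qpi x = qpi y <-> x - y \in H.
Proof. by rewrite Quotient.idealrBE; split => [e|/eqP //]; apply/eqP. Qed.

Lemma qpi_eq0 x : qpi x = 0 <-> x \in H.
Proof. by rewrite -[x in x \in H]subr0 -qpi_eq raddf0. Qed.

Lemma qpi_continuous : continuous qpi.
Proof. exact: pi_continuous. Qed.

Lemma qpi_open (U : set T) : open U -> open (qpi @` U).
Proof.
move=> oU; rewrite /open /= /quotient_open.
rewrite (_ : _ @^-1` _ = \bigcup_(h in [set h | h \in H]) ((fun x => x + h) @^-1` U)).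
  apply: bigcup_open => h _; apply: open_comp => // x _; exact: continuous_addrr.
apply/seteqP; split=> [x /= [u Uu /qpi_eq ux]|x [h /= hH Ux]].
  by exists (u - x) => //=; rewrite addrC subrK.
by exists (x + h) => //; apply/qpi_eq; rewrite addrC addKr.
Qed.

Lemma quotient_hausdorff : closed [set x | x \in H] -> hausdorff_space Q.
Proof.
move=> clH; rewrite open_hausdorff => p q.
have [x <-] := qpi_surj p; have [y <-] := qpi_surj q => pq.
have nH : ~ (x - y \in H) by move=> /qpi_eq e; rewrite e eqxx in pq.
have oH : open (~` [set x | x \in H]) by exact: closed_openC.
have [[A B] /= [nA nB] AB] := @sub_continuous T (x, y) _ (open_nbhs_nbhs (conj oH nH)).
exists (qpi @` A°, qpi @` B°).
  by rewrite !inE; split; [exists x|exists y].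
split; [by apply: qpi_open; exact: open_interior..|].
apply/eqP/seteqP; split => // _ [[a /interior_subset Aa <-] [b /interior_subset Bb /qpi_eq ba]].
apply: (AB (a, b)) => //=.
by rewrite -opprB rpredN.
Qed.

Lemma quotient_locally_compact :
  hausdorff_space Q -> locally_compact [set: T] -> locally_compact [set: Q].
Proof.
move=> hQ lT q _; have [x <-] := qpi_surj q.
have [U nU [cU clU]] := lT x I.
rewrite withinET in nU.
have cqU : compact (qpi @` U).
  by apply: continuous_compact => //; apply: continuous_subspaceT; exact: qpi_continuous.
exists (qpi @` U); last by split => //; exact: compact_closed.
rewrite withinET.
apply: (@filterS _ _ _ (qpi @` U°)).
  by apply: image_subset; exact: interior_subset.
apply: open_nbhs_nbhs; split; last by exists x => //.
by apply: qpi_open; exact: open_interior.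
Qed.

End Quotients.

Section CircleGroup.
Variable R : realType.
Local Notation T := (circle R).

Definition toT : {additive R -> T} := (qpi (int_subgroup R) : {additive _ -> _}).

Lemma toT_surj (t : T) : exists x, toT x = t.
Proof. exact: qpi_surj. Qed.

Lemma toT_eq0 x : toT x = 0 <-> x \is a Num.int.
Proof. by rewrite /toT qpi_eq0. Qed.

Lemma toT_eq x y : toT x = toT y <-> x - y \is a Num.int.
Proof. by rewrite /toT qpi_eq. Qed.

Lemma toT_continuous : continuous toT.
Proof. exact: qpi_continuous. Qed.

Definition cosT (x : R) : R := cos (pi *+ 2 * x).
Definition sinT (x : R) : R := sin (pi *+ 2 * x).

Lemma cosTB x y : cosT (x - y) = cosT x * cosT y + sinT x * sinT y.
Proof. by rewrite /cosT /sinT mulrBr cosB. Qed.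

Lemma cosT_sinT_int (k : int) : cosT k%:~R = 1 /\ sinT k%:~R = 0.
Proof.
have nat_case (n : nat) : cosT n%:R = 1 /\ sinT n%:R = 0.
  rewrite /cosT /sinT; elim: n => [|n [IHc IHs]].
    by rewrite mulr0 cos0 sin0.
  by rewrite -natr1 mulrDr mulr1 cosD2pi sinD2pi.
case: k => n; first exact: nat_case.
have [hc hs] := nat_case n.+1.
rewrite NegzE mulrNz; split.
  by rewrite /cosT mulrN cosN.
by rewrite /sinT mulrN sinN [sin _]hs oppr0.
Qed.

(** The double-angle formula turns the equation into [sin (pi * f) = 0] for the fractional part [f]
    of [x], and the sine is positive on the open interval from 0 to [pi]. *)
Lemma cosT_eq1 (x : R) : cosT x = 1 <-> x \is a Num.int.
Proof.
split; last by move=> /intrP[k ->]; exact: (cosT_sinT_int k).1.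
move=> c1; have [kc ks] := cosT_sinT_int (Num.floor x).
set f := x - (Num.floor x)%:~R.
have f0 : 0 <= f by rewrite subr_ge0 floor_le.
have f1 : f < 1.
  by rewrite ltrBlDr addrC -intrD1; exact: floorD1_gt.
have : cosT f = 1 by rewrite cosTB c1 kc ks mulr0 addr0 mulr1.
rewrite /cosT mulrnAl cos_mulr2n => cf.
have sf : sin (pi * f) = 0.
  by apply/eqP; rewrite -sqrf_eq0 sin2cos2; apply/eqP; move: cf; lra.
have [fp|] := ltP 0 f.
  have : 0 < sin (pi * f).
    by apply: sin_gt0_pi; rewrite mulr_gt0 ?pi_gt0//= gtr_pMr ?pi_gt0//.
  by rewrite sf ltxx.
move=> fn; have /eqP : f = 0 by lra.
by rewrite subr_eq0 => /eqP e; rewrite e intr_int.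
Qed.

Lemma continuous_cosT : continuous cosT.
Proof.
move=> x; apply: (@continuous_comp _ _ _ (fun x => pi *+ 2 * x) (@cos R)).
  by apply: cvgM; [exact: cvg_cst|exact: cvg_id].
exact: continuous_cos.
Qed.

Lemma continuous_sinT : continuous sinT.
Proof.
move=> x; apply: (@continuous_comp _ _ _ (fun x => pi *+ 2 * x) (@sin R)).
  by apply: cvgM; [exact: cvg_cst|exact: cvg_id].
exact: continuous_sin.
Qed.

Lemma circle_hausdorff : hausdorff_space T.
Proof.
apply: quotient_hausdorff.
rewrite (_ : [set _ | _] = cosT @^-1` [set 1]).
  have /continuous_closedP := continuous_cosT; apply.
  by apply: accessible_closed_set1; exact/hausdorff_accessible/Rhausdorff.
by apply/seteqP; split=> x; rewrite /= int_subgroupE cosT_eq1.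
Qed.

Lemma circle_compact : compact [set: T].
Proof.
rewrite (_ : [set: T] = toT @` `[0, 1]%classic).
  apply: continuous_compact; last exact: segment_compact.
  by apply: continuous_subspaceT; exact: toT_continuous.
apply/seteqP; split => // t _; have [x <-] := toT_surj t.
exists (x - (Num.floor x)%:~R).
  rewrite /= in_itv /= subr_ge0 floor_le lerBlDr addrC.
  by have := floorD1_gt x; rewrite intrD => /ltW.
by apply/toT_eq; rewrite addrAC subrr sub0r rpredN intr_int.
Qed.

(** The embedding onto the unit circle of the plane; by periodicity every representative gives the
    same point. *)
Definition planeT (t : T) : R * R := (cosT (repr t), sinT (repr t)).

Lemma cosT_sinT_eq x y : cosT x = cosT y -> sinT x = sinT y -> toT x = toT y.
Proof.
move=> cxy sxy; apply/toT_eq/cosT_eq1; rewrite cosTB cxy sxy.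
by rewrite /cosT /sinT -!expr2 cos2Dsin2.
Qed.

Lemma planeTE x : planeT (toT x) = (cosT x, sinT x).
Proof.
have : toT (repr (toT x)) = toT x by exact: reprK.
move=> /toT_eq/intrP[k /eqP]; rewrite subr_eq => /eqP e.
rewrite /planeT e /cosT /sinT mulrDr cosD sinD.
have [] := cosT_sinT_int k; rewrite /cosT /sinT => -> ->.
by congr pair; ring.
Qed.

Lemma planeT_inj : injective planeT.
Proof.
move=> s t; have [x <-] := toT_surj s; have [y <-] := toT_surj t.
by rewrite !planeTE => -[]; exact: cosT_sinT_eq.
Qed.

Lemma continuous_planeT : continuous planeT.
Proof.
apply/quotient_continuous.
rewrite (_ : _ \o _ = fun x => (cosT x, sinT x)); last first.
  by apply/funext => x /=; exact: (planeTE x).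
by move=> x; exact: (cvg_pair (@continuous_cosT x) (@continuous_sinT x)).
Qed.

Lemma unit_circle_param (c s : R) : c ^+ 2 + s ^+ 2 = 1 ->
  exists t : T, planeT t = (c, s).
Proof.
move=> cs.
have c1 : -1 <= c <= 1.
  rewrite -ler_norml -(@ler_pXn2r _ 2)// ?nnegrE// expr1n real_normK ?num_real//.
  by have := sqr_ge0 s; lra.
have sE : `|s| = sin (acos c).
  rewrite sin_acos// -cs addrAC subrr add0r; exact/esym/sqrtr_sqr.
have [ac cac] := acos_def c1.
have p2 : pi *+ 2 != 0 :> R by rewrite mulrn_eq0 /= gt_eqF// pi_gt0.
have [s0|s0] := leP 0 s.
  exists (toT (acos c / (pi *+ 2))).
  rewrite planeTE /cosT /sinT mulrC divfK// cac -sE ger0_norm//.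
exists (toT (- (acos c / (pi *+ 2)))).
rewrite planeTE /cosT /sinT mulrN mulrC divfK// cosN sinN cac -sE ltr0_norm//.
by rewrite opprK.
Qed.

(* With [v x0 = cos t0] and [s0 = sin t0 <> 0], the function
   [x |-> (v (x - x0) - v (x + x0)) / (2 s0)] is the sine companion of [v]. *)
Lemma character_of_dalembert (G : topologicalZmodType) (v : G -> R) (a x0 : G) :
  continuous v -> v 0 = 1 -> even_function v ->
  (forall y x, v (x + y) + v (x - y) = 2 * v y * v x) -> v a != 1 ->
  v x0 ^+ 2 < 1 ->
  exists chi : {additive G -> T}, continuous chi /\ chi a != 0.
Proof.
move=> cv v0 ev D va vx0.
pose s0 := Num.sqrt (1 - v x0 ^+ 2).
have s00 : 0 < s0 by rewrite sqrtr_gt0 subr_gt0.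
have s02 : s0 ^+ 2 = 1 - v x0 ^+ 2 by rewrite sqr_sqrtr// subr_ge0 ltW.
pose s x := (v (x - x0) - v (x + x0)) / (2 * s0).
have sn : s0 != 0 by rewrite gt_eqF.
have shift x : v (x + x0) = v x * v x0 - s x * s0.
  have -> : s x * s0 = (v (x - x0) - v (x + x0)) / 2 by rewrite /s; field.
  have := D x0 x; lra.
have sadd x y : s (x + y) + s (x - y) = 2 * s x * v y.
  have h1 := D y (x - x0); have h2 := D y (x + x0).
  have -> : s (x + y) + s (x - y) = ((v (x - x0 + y) + v (x - x0 - y)) -
      (v (x + x0 + y) + v (x + x0 - y))) / (2 * s0).
    by rewrite /s (addrAC x y (- x0)) (addrAC x y x0) (addrAC x (- y) (- x0))
      (addrAC x (- y) x0); field.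
  by rewrite h1 h2 /s; field.
have sodd x : s (- x) = - s x.
  have e1 : - x - x0 = - (x + x0) by rewrite opprD.
  have e2 : - x + x0 = - (x - x0) by rewrite opprB addrC.
  by rewrite /s e1 e2 !ev; field.
(* Adding the previous identity to the one with [x] and [y] exchanged removes the differences, since
   [s] is odd. *)
have sD x y : s (x + y) = s x * v y + s y * v x.
  have h1 := sadd x y; have h2 := sadd y x.
  have h3 : s (y - x) = - s (x - y) by rewrite -sodd opprB.
  by rewrite h3 (addrC y) in h2; lra.
(* Expand [s (x + y + x0)] with the sine formula in two ways and cancel [s0 = s x0]. *)
have vD x y : v (x + y) = v x * v y - s x * s y.
  apply: (mulfI sn).
  have sx0 : s x0 = s0.
    rewrite /s subrr v0 (_ : v (x0 + x0) = 2 * v x0 ^+ 2 - 1).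
      rewrite (_ : 1 - (2 * v x0 ^+ 2 - 1) = 2 * s0 ^+ 2) ?s02; last by ring.
      by rewrite -s02; field.
    by have := D x0 x0; rewrite subrr v0 expr2; lra.
  have h1 := sD (x + y) x0; have h2 := sD x (y + x0); have h3 := sD y x0.
  rewrite addrA in h2; rewrite h1 sx0 h3 sx0 (sD x y) shift in h2.
  have : s0 * v (x + y) = s x * (v y * v x0 - s y * s0) +
      (s y * v x0 + s0 * v y) * v x - (s x * v y + s y * v x) * v x0.
    by move: h2; lra.
  by move=> ->; ring.
have vs1 x : v x ^+ 2 + s x ^+ 2 = 1.
  by have := vD x (- x); rewrite subrr v0 ev sodd; lra.
have /choice[chi chiP] : forall x, exists t : T, planeT t = (v x, s x).
  by move=> x; exact: unit_circle_param.
have chiB : zmod_morphism chi.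
  move=> x y; apply: planeT_inj.
  have [p pE] := toT_surj (chi x); have [q qE] := toT_surj (chi y).
  have := chiP x; have := chiP y; rewrite -pE -qE !planeTE => -[cq sq] [cp inner].
  rewrite -raddfB planeTE chiP vD sD ev sodd -cq -sq -cp -inner.
  by rewrite cosTB /sinT mulrBr sinB; congr pair; rewrite /cosT /sinT; ring.
exists (additive_of chiB); split.
  apply: (continuous_factor circle_compact _ continuous_planeT planeT_inj).
    exact: norm_hausdorff.
  rewrite (_ : _ \o _ = fun x => (v x, s x)); last by apply/funext => x; exact: chiP.
  have cs : continuous s.
    rewrite /s; apply: continuous_mulf; last exact: continuous_cst.
    by apply: continuous_subf; exact: continuous_shift.
  by move=> x; exact: (cvg_pair (@cv x) (@cs x)).
apply/eqP => /= c0; move: va; rewrite -[v a]/((v a, s a).1) -chiP c0.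
by rewrite -(raddf0 toT) planeTE /= /cosT mulr0 cos0 eqxx.
Qed.

(* On a 2-divisible group a solution of d'Alembert's equation with values in
   [{1, -1}] is constant. *)
Lemma enough_characters (G : topologicalZmodType) (a : G) :
  hausdorff_space G -> compact [set: G] -> (forall x : G, exists y, x = y *+ 2) ->
  a != 0 -> exists chi : {additive G -> T}, continuous chi /\ chi a != 0.
Proof.
move=> hG cG dG a0.
have [v [cv v0 [ev v1] D va]] := dalembert_separates R hG cG a0.
have dbl x : v (x *+ 2) = 2 * v x ^+ 2 - 1.
  by have := D x x; rewrite subrr v0 mulr2n expr2; lra.
have [[x0 vx0]|H] := pselect (exists x0, v x0 ^+ 2 < 1).
  exact: character_of_dalembert va vx0.
exfalso; have [y ya] := dG a.
have le1 x : v x ^+ 2 = 1.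
  apply/eqP; rewrite eq_le; apply/andP; split.
    by rewrite -real_normK ?num_real// expr_le1.
  by rewrite leNgt; apply/negP => vx; apply: H; exists x.
by move: va; rewrite ya dbl le1 => /eqP; apply; ring.
Qed.

End CircleGroup.

(** * Extensions by a compact group *)

Section ImageSubgroup.
Variables (A B : zmodType) (phi : {additive A -> B}).

Definition image_subgroup : {pred B} := fun b => `[< exists a, phi a = b >].

Lemma image_subgroupP b : reflect (exists a, phi a = b) (b \in image_subgroup).
Proof. exact: asboolP. Qed.

Lemma image_subgroup_closed : zmod_closed image_subgroup.
Proof.
split=> [|x y /image_subgroupP[a <-] /image_subgroupP[b <-]]; apply/image_subgroupP.
  by exists 0; rewrite raddf0.
by exists (a - b); rewrite raddfB.
Qed.

HB.instance Definition _ :=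
  GRing.isZmodClosed.Build B image_subgroup image_subgroup_closed.

End ImageSubgroup.

Lemma splits_retraction (A B C : topologicalZmodType)
    (phi : {additive A -> B}) (psi : {additive B -> C}) :
  splits phi psi ->
  exists r : {additive B -> A}, continuous r /\ forall a, r (phi a) = a.
Proof.
move=> [beta [[cb _] bphi _]].
have rB : zmod_morphism (fun b => (beta b).1) by move=> x y; rewrite raddfB.
exists (additive_of rB); split=> [b|a] /=; last by have /= -> := bphi a.
apply: (@continuous_comp _ _ _ beta (fst : A * C -> A)); first exact: cb.
exact: cvg_fst.
Qed.

Section QuotientExtension.
Variables (A B : topologicalZmodType) (phi : {additive A -> B}).
Hypotheses (cA : compact [set: A]) (hB : hausdorff_space B).
Hypotheses (cphi : continuous phi) (iphi : injective phi).

Definition coker : topologicalZmodType :=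
  quotient_topology {ideal_quot (image_subgroup phi : zmodClosed B)}.

Definition coker_pi : {additive B -> coker} :=
  (qpi (image_subgroup phi : zmodClosed B) : {additive _ -> _}).

Lemma coker_pi_eq0 b : coker_pi b = 0 <-> exists a, phi a = b.
Proof.
rewrite /coker_pi; split=> [/qpi_eq0/image_subgroupP//|e].
by apply/qpi_eq0/image_subgroupP.
Qed.

Lemma coker_pi_surj (x : coker) : exists b, coker_pi b = x.
Proof. exact: qpi_surj. Qed.

Lemma coker_pi_continuous : continuous coker_pi.
Proof. exact: qpi_continuous. Qed.

Lemma closed_embedding (S : set A) : closed S -> closed (phi @` S).
Proof. exact: compact_to_hausdorff_closed. Qed.

Lemma coker_hausdorff : hausdorff_space coker.
Proof.
apply: quotient_hausdorff.
rewrite (_ : [set _ | _] = phi @` setT); first by apply: closed_embedding; exact: closedT.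
apply/seteqP; split=> [b /image_subgroupP[a <-]|b [a _ <-]]; first by exists a.
by apply/image_subgroupP; exists a.
Qed.

Lemma coker_LCA : locally_compact [set: B] -> LCA coker.
Proof.
move=> lB; split; first exact: coker_hausdorff.
by apply: quotient_locally_compact => //; exact: coker_hausdorff.
Qed.

Lemma closed_embedding_proper (S : set A) : proper_on S phi.
Proof.
move=> U /open_subspaceP[V oV VU]; apply/open_subspaceP.
exists (~` (phi @` ~` V)).
  by apply: closed_openC; apply: closed_embedding; exact: open_closedC.
apply/seteqP; split=> b; [move=> [nV [a Sa ab]]|move=> [[a [Sa Ua] ab] _]].
  split; last by exists a.
  exists a => //; split => //; have : (V `&` S) a.
    split => //; apply: contrapT => nVa; apply: nV; exists a => //.
  by rewrite VU => -[].
have : (U `&` S) a by [].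
rewrite -VU => -[Va _]; split; last by exists a.
by move=> [a' nVa' /esym]; rewrite -ab => /iphi e; apply: nVa'; rewrite -e.
Qed.

Lemma coker_extension : extension phi coker_pi.
Proof.
split.
- exact: continuous_subspaceT.
- by apply: continuous_subspaceT; exact: coker_pi_continuous.
- exact: closed_embedding_proper.
- move=> U /open_subspaceP[V oV VU]; apply/open_subspaceP.
  exists (coker_pi @` V); first exact: qpi_open.
  rewrite !setIT in VU; rewrite setTI VU; apply/seteqP; split=> x [] //.
- by move=> x y _ _; exact: iphi.
- apply/seteqP; split=> [_ [a _ <-]|b [_ /= /coker_pi_eq0[a <-]]]; last by exists a.
  by split => //=; apply/coker_pi_eq0; exists a.
- by apply/seteqP; split => // x _; have [b <-] := coker_pi_surj x; exists b.
Qed.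

Lemma closure_embedding (S : set A) : closure (phi @` S) = phi @` closure S.
Proof.
apply/seteqP; split.
  rewrite [X in _ `<=` X](iffLR (closure_id (phi @` closure S))); last first.
    by apply: closed_embedding; exact: closed_closure.
  by apply: closureS; apply: image_subset; exact: subset_closure.
move=> _ [a Sa <-] V nV; have [a' [Sa' Va']] := Sa _ (cphi nV).
by exists (phi a'); split => //; exists a'.
Qed.

(* When the quotient has finite exponent, [B^(1) = A^(1)]. *)
Lemma coker_tfu_exponent (n : nat) : (0 < n)%N ->
  (forall x : coker, x *+ n = 0) -> tfu_extension phi coker_pi.
Proof.
move=> n0 nX; split; first exact: coker_extension.
have ulmB : ulm1 B = phi @` ulm1 A.
  apply/seteqP; split=> [b bB|_ [a aA <-] m m0].
    have nB y : exists a, phi a = y *+ n.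
      by apply/coker_pi_eq0; rewrite raddfMn nX.
    have [y _ yb] := bB n n0; have [a ay] := nB y.
    exists a; last by rewrite ay.
    (* An element of [B] divisible by [n * m] is [m] times an [n]-fold multiple, and [n]-fold
       multiples already lie in the image of [A]. *)
    move=> m m0; have nm0 : (0 < n * m)%N by rewrite muln_gt0 n0.
    have [z _ zb] := bB (n * m)%N nm0.
    have [a' a'z] := nB z; exists a' => //.
    by apply: iphi; rewrite ay yb -zb mulrnA -a'z raddfMn.
  by have [y _ <-] := aA m m0; exists (phi y); rewrite ?raddfMn.
have ulmX : ulm1 coker = [set 0].
  apply/seteqP; split=> [x xX|_ -> m m0]; first by have [y _ <-] := xX n n0; exact: nX.
  by exists 0; rewrite ?mul0rn.
have cl0 : closure [set (0 : coker)] = [set 0].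
  by apply/esym/closure_id; exact: accessible_closed_set1 (hausdorff_accessible coker_hausdorff) 0.
rewrite ulmX ulmB closure_embedding cl0.
have psi0 a : coker_pi (phi a) = 0 by apply/coker_pi_eq0; exists a.
have zA : closure (ulm1 A) 0.
  by apply: subset_closure => m _; exists 0; rewrite ?mul0rn.
have img : coker_pi @` (phi @` closure (ulm1 A)) = [set 0].
  apply/seteqP; split=> [_ [_ [a _ <-] <-]|_ ->]; first exact: psi0.
  by exists (phi 0); [exists 0|exact: psi0].
split.
- exact: continuous_subspaceT.
- by apply: continuous_subspaceT; exact: coker_pi_continuous.
- exact: closed_embedding_proper.
- move=> U _; rewrite img; apply/open_subspaceP.
  set W := coker_pi @` _.
  have [w0|nw0] := pselect (W 0).
    exists setT; first exact: openT.
    by apply/seteqP; split=> x [] // _ ->.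
  exists set0; first exact: open0.
  by apply/seteqP; split=> x [] // + e; rewrite e.
- by move=> x y _ _; exact: iphi.
- apply/seteqP; split=> [_ [a Aa <-]|_ [[a Aa <-] _]]; last by exists a.
  by split; [exists a|exact: psi0].
- exact: img.
Qed.

Definition divisible (D : zmodType) := forall (n : nat) (x : D), (0 < n)%N ->
  exists y, y *+ n = x.

Lemma divisible_ulm1 (D : topologicalZmodType) : divisible D -> ulm1 D = setT.
Proof.
move=> dD; apply/seteqP; split => // x _ m m0.
by have [y <-] := dD m x m0; exists y.
Qed.

Lemma coker_tfu_divisible :
  divisible A -> divisible B -> tfu_extension phi coker_pi.
Proof.
move=> dA dB; split; first exact: coker_extension.
have dX : divisible coker.
  move=> m x m0; have [b <-] := coker_pi_surj x; have [y <-] := dB m b m0.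
  by exists (coker_pi y); rewrite raddfMn.
have clT (D : topologicalZmodType) : divisible D -> closure (ulm1 D) = setT.
  by move=> dD; rewrite (divisible_ulm1 dD); apply/esym/closure_id; exact: closedT.
by rewrite !clT//; exact: coker_extension.
Qed.

End QuotientExtension.

(** * Extensions with cyclic quotient force divisibility *)

Section Divisibility.
Variable G : topologicalZmodType.
Hypotheses (hG : hausdorff_space G) (cG : compact [set: G]).
Variables (g : G) (n : nat).
Hypothesis n0 : (0 < n)%N.
Local Notation Z := (discrete_topology int).
Local Notation D := (dirsum G Z).

Definition relator (k : int) : D := (g *~ k, (- (k * n%:Z))%R : Z).

Lemma relator_zmod_morphism : zmod_morphism relator.
Proof.
move=> i j; congr pair; first exact: mulrzBr.
have E : - ((i - j) * n%:Z) = - (i * n%:Z) - - (j * n%:Z) by ring.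
exact: E.
Qed.

HB.instance Definition _ :=
  GRing.isZmodMorphism.Build int D relator relator_zmod_morphism.

Local Notation H := (image_subgroup (relator : {additive int -> D}) : zmodClosed D).

(* The group [(G + Z) / <(g, -n)>], in which [g] becomes divisible by [n]. *)
Definition adjoin_div : topologicalZmodType := quotient_topology {ideal_quot H}.

Definition adjoin_incl (a : G) : adjoin_div := qpi H ((a, 0) : D).

Lemma adjoin_incl_zmod_morphism : zmod_morphism adjoin_incl.
Proof.
move=> a b; rewrite /adjoin_incl -raddfB; congr (qpi H _).
Qed.

HB.instance Definition _ :=
  GRing.isZmodMorphism.Build G adjoin_div adjoin_incl adjoin_incl_zmod_morphism.

Lemma nbhs_slice (a : G) (k : Z) (U : set G) : nbhs a U ->
  nbhs ((a, k) : D) [set z : D | U z.1 /\ z.2 = k].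
Proof.
by move=> nU; exists (U, [set k]) => //=; split => //=; exact: discrete_set1.
Qed.

(** As [n] is positive, the integer coordinate determines the multiple of the relator, so each open
    slice with fixed integer coordinate meets the subgroup in at most one point. *)
Lemma relator_closed : closed [set x : D | x \in H].
Proof.
move=> [a k] clx; apply/image_subgroupP.
have n0z : n%:Z != 0 by rewrite eqz_nat -lt0n.
have [[b l] [/image_subgroupP[j jE] [_ /= lk]]] := clx _ (nbhs_slice k (@filterT _ (nbhs a) _)).
have kE : k = - (j * n%:Z) by rewrite -lk; case: jE => _ <-.
exists j; congr pair; last by rewrite kE.
apply: hG => U V nU nV.
have [[b' l'] [/image_subgroupP[j' j'E] [/= Vb' l'k]]] := clx _ (nbhs_slice k nV).
exists (g *~ j); split; first exact: nbhs_singleton.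
case: j'E => bE lE; move: Vb'; rewrite -bE.
suff -> : j' = j by [].
apply: (mulIf n0z); apply: oppr_inj; rewrite -kE -l'k; exact: lE.
Qed.

Lemma adjoin_div_LCA : LCA adjoin_div.
Proof.
have hB : hausdorff_space adjoin_div by apply: quotient_hausdorff; exact: relator_closed.
split => //; apply: quotient_locally_compact => //.
move=> [a k] _; rewrite withinET.
exists [set z : D | setT z.1 /\ z.2 = k]; first exact: nbhs_slice filterT.
have cK : compact ([set z : D | setT z.1 /\ z.2 = k]).
  by apply: (@compact_setX G Z setT [set k]) => //; exact: compact_set1.
split => //.
move=> [b l] cl; split => //=.
by have [z [[_ zk] [_ zl]]] := cl _ (nbhs_slice l (@filterT _ (nbhs b) _)); rewrite -zk -zl.
Qed.

Lemma adjoin_incl_continuous : continuous adjoin_incl.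
Proof.
apply: (@continuous_fcomp _ _ _ (fun a => (a, 0) : D) (qpi H)); last exact: qpi_continuous.
move=> a U /= [[P Q] /= [nP nQ] PQ]; apply: filterS nP => b Pb.
by apply: PQ; split => //=; exact: nbhs_singleton.
Qed.

Lemma adjoin_incl_injective : injective adjoin_incl.
Proof.
move=> a b /qpi_eq/image_subgroupP[k [kE k0]].
have n0z : n%:Z != 0 by rewrite eqz_nat -lt0n.
have : k = 0.
  by move: k0; rewrite subr0 => /eqP; rewrite oppr_eq0 mulf_eq0 (negbTE n0z) orbF => /eqP.
by move=> e; move: kE; rewrite e mulr0z => /esym/eqP; rewrite subr_eq0 => /eqP.
Qed.

Lemma dirsum_mulrn (a : G) (k : Z) m : ((a, k) : D) *+ m = ((a *+ m, k *+ m) : D).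
Proof. by elim: m => [//|m IH]; rewrite !mulrS IH. Qed.

Lemma discrete_mulrn (k : int) m : (k : Z) *+ m = (k * m%:Z : int).
Proof.
have E : k *+ m = k * m%:Z by rewrite -mulr_natr natz.
exact: E.
Qed.

Lemma adjoin_divE : (qpi H ((0, 1) : D)) *+ n = adjoin_incl g.
Proof.
rewrite -raddfMn dirsum_mulrn; apply/qpi_eq/image_subgroupP; exists (-1).
congr pair; first by rewrite mul0rn sub0r mulrNz mulr1z.
have E : - (-1 * n%:Z) = 1 * n%:Z - 0 by ring.
by rewrite discrete_mulrn; exact: E.
Qed.

Lemma coker_adjoin_exponent (x : coker (adjoin_incl : {additive _ -> _})) : x *+ n = 0.
Proof.
have [q <-] := coker_pi_surj x; have [[a k] <-] := qpi_surj q.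
(* Modulo the relator, [n] times the integer [k] equals [k] times [g]. *)
rewrite -raddfMn; apply/coker_pi_eq0; exists (a *+ n + g *~ k).
change (qpi H ((a *+ n + g *~ k, 0) : D) = qpi H ((a, k) : D) *+ n).
rewrite -raddfMn dirsum_mulrn; apply/qpi_eq/image_subgroupP; exists (k : int).
congr pair; first by rewrite addrAC subrr add0r.
have E : - ((k : int) * n%:Z) = 0 - (k : int) * n%:Z by rewrite sub0r.
by rewrite discrete_mulrn; exact: E.
Qed.

Lemma divides_of_Ext :
  (forall X : topologicalZmodType, LCA X -> Ext_tfu_trivial X G) ->
  exists y, y *+ n = g.
Proof.
move=> Gext.
have [hB lB] := adjoin_div_LCA.
have LX := coker_LCA cG hB adjoin_incl_continuous lB.
have tfu := coker_tfu_exponent cG hB adjoin_incl_continuous adjoin_incl_injective n0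
  coker_adjoin_exponent.
have [r [_ rK]] := splits_retraction (Gext _ LX _ _ _ (conj hB lB) tfu).
by exists (r (qpi H ((0, 1) : D))); rewrite -raddfMn adjoin_divE rK.
Qed.

End Divisibility.

(** * Retracts of tori *)

Section CircleCharacters.
Variable R : realType.
Local Notation T := (circle R).
Local Notation toT := (toT R).

Definition small (e : R) : set T := [set toT x | x in [set x : R | `|x| < e]].

Lemma nbhs_small (e : R) : 0 < e -> nbhs (0 : T) (small e).
Proof.
move=> e0; apply: open_nbhs_nbhs; split; last by exists 0; rewrite /= ?normr0 ?raddf0.
apply: qpi_open.
have -> : [set x : R | `|x| < e] = ball (0 : R) e.
  by apply/seteqP; split => x; rewrite /ball /= sub0r normrN.
exact: ball_open.
Qed.

Lemma int_lt1 (x : R) : x \is a Num.int -> `|x| < 1 -> x = 0.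
Proof.
move=> /intrP[k ->]; rewrite -intr_norm ltrz1 => k1.
by have -> : k = 0 by lia.
Qed.

(** Doubling argument: if a lift of a multiple of [t] is below 1/4 in absolute value, its double and
    the small lift of the doubled element differ by an integer of absolute value below 3/4, so they
    agree. All [x0 * 2 ^+ j] then stay bounded, which forces [x0 = 0]. *)
Lemma no_small_subgroups (t : T) :
  (forall m : nat, small (1 / 4) (t *+ m)) -> t = 0.
Proof.
move=> H; have [x0 /= x04 x0t] : small (1 / 4) t by rewrite -[t]mulr1n.
have dbl j : `|x0 * 2 ^+ j| < 1 / 4.
  elim: j => [|j IH]; first by rewrite expr0 mulr1.
  have [y /= y4 yt] := H (2 ^ j.+1)%N.
  have E : toT (x0 * 2 ^+ j.+1) = t *+ (2 ^ j.+1)%N.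
    by rewrite -x0t -raddfMn -(mulr_natr x0) natrX.
  rewrite -E in yt.
  have {}yt := (toT_eq _ _).1 yt.
  have /eqP : y - x0 * 2 ^+ j.+1 = 0.
    apply: int_lt1 => //; move: IH y4; rewrite exprS mulrCA !ltr_norml.
    by set z := x0 * _; lra.
  by rewrite subr_eq0 => /eqP <-.
suff x00 : x0 = 0 by rewrite -x0t x00 raddf0.
apply/eqP; rewrite -normr_le0 leNgt; apply/negP => x0p.
pose n := (Num.trunc (`|x0|^-1)).+1.
have h1 : `|x0|^-1 < n%:R by exact: truncnS_gt.
have h2 : n%:R <= 2 ^+ n :> R by rewrite -natrX ler_nat ltnW// ltn_expl.
have := dbl n; rewrite normrM [X in _ * X]ger0_norm ?exprn_ge0//.
rewrite ltNge => /negP; apply; apply: (@le_trans _ _ 1); first lra.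
by rewrite mulrC -ler_pdivrMr// mul1r; apply: le_trans h2; exact: ltW.
Qed.

(** Subtract from the lifted character the linear map agreeing with it at a small [h]. The
    difference has period [h] and is small on one period (1/8 from each part), so its image is a
    small subgroup and vanishes; the slope is an integer because the character kills the class of
    1. *)
Lemma circle_character (chi : {additive T -> T}) : continuous chi ->
  exists n : int, forall t, chi t = t *~ n.
Proof.
move=> cchi.
have cpsi : continuous (chi \o toT).
  by move=> x; apply: continuous_comp; [exact: toT_continuous|exact: cchi].
have e8 : 0 < 1 / 8 :> R by lra.
have : nbhs (0 : R) ((chi \o toT) @^-1` small (1 / 8)).
  by apply: cpsi => /=; rewrite !raddf0; exact: nbhs_small.
move=> /nbhs_ballP[d /= d0 dP].
pose N := (Num.trunc d^-1).+1.
pose h : R := N%:R^-1.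
have h0 : 0 < h by rewrite invr_gt0.
have hd : h < d by rewrite invf_plt ?posrE//; exact: truncnS_gt.
have psi_small x : `|x| <= h -> small (1 / 8) (chi (toT x)).
  by move=> xh; apply: dP; rewrite /ball /= sub0r normrN; exact: le_lt_trans hd.
have [th th8 thE] : small (1 / 8) (chi (toT h)).
  by apply: psi_small; rewrite ger0_norm// ltW.
pose c := th / h.
pose psi' x := chi (toT x) - toT (c * x).
have psi'B : zmod_morphism psi'.
  move=> x y; rewrite /psi' mulrBr !(raddfB toT) (raddfB chi) !opprB (addrC (toT (c * y))) addrACA.
  by congr (_ + _); rewrite addrC.
pose psi := additive_of psi'B.
have psih : psi h = 0 by rewrite -[psi h]/(psi' h) /psi' /c divfK ?gt_eqF// thE subrr.
have psis x : `|x| <= h -> small (1 / 4) (psi x).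
  move=> xh; have [y y8 yE] := psi_small x xh.
  exists (y - c * x); last by rewrite -[psi x]/(psi' x) /psi' raddfB yE.
  have : `|c * x| <= `|th|.
    by rewrite /c normrM normf_div (gtr0_norm h0) mulrAC ler_pdivrMr// ler_wpM2l.
  have th8' : `|th| < 1 / 8 := th8; have y8' : `|y| < 1 / 8 := y8.
  by move=> cx; apply: le_lt_trans (ler_normB _ _) _; lra.
have psi0 x : psi x = 0.
  apply: no_small_subgroups => m; rewrite -raddfMn.
  set y := x *+ m; pose q := Num.floor (y / h).
  have -> : psi y = psi (y - h *~ q) by rewrite raddfB raddfMz psih mul0rz subr0.
  apply: psis; rewrite ger0_norm -mulrzl.
    rewrite lerBlDr -[X in X + _]mul1r -mulrDl -ler_pdivrMr// addrC -intrD1.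
    exact/ltW/floorD1_gt.
  by rewrite subr_ge0 -ler_pdivlMr// floor_le.
have c_int : c \is a Num.int.
  apply/toT_eq0; have := psi0 1; rewrite -[psi 1]/(psi' 1) /psi' mulr1.
  by rewrite (_ : toT 1 = 0) ?raddf0 ?sub0r => [/eqP|]; [rewrite oppr_eq0 => /eqP|exact/toT_eq0].
have /intrP[n nE] := c_int; exists n => t; have [x <-] := toT_surj t.
have := psi0 x; rewrite -[psi x]/(psi' x) /psi' => /eqP; rewrite subr_eq0 => /eqP ->.
by rewrite nE mulrzl raddfMz.
Qed.

End CircleCharacters.

Section ProductTopology.
Variable I : choiceType.

Lemma continuous_to_prod (X : topologicalType) (K : I -> topologicalType)
    (f : X -> prod_topology K) :
  (forall i, continuous (fun x => f x i)) -> continuous f.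
Proof.
move=> cf x; apply/cvg_sup => i A [B [[W oW <-] Wx BA]].
by apply: filterS BA _; apply: (cf i x W); exact: open_nbhs_nbhs.
Qed.

End ProductTopology.

(** * Characters of a torus *)

Section TorusCharacters.
Variables (R : realType) (I : choiceType).
Local Notation T := (circle R).
Local Notation P := (prod_topology (fun _ : I => T)).

Definition single (i : I) (t : T) : P := fun j => if j == i then t else 0.

Lemma single_zmod_morphism i : zmod_morphism (single i).
Proof.
move=> s t; apply/funext => j; rewrite /single.
change ((if j == i then s - t else 0) = (if j == i then s else 0) - (if j == i then t else 0)).
by case: (j == i); rewrite ?subr0.
Qed.

Lemma continuous_single i : continuous (single i).
Proof.
apply: continuous_to_prod => j; case ji: (j == i).
  rewrite (_ : (fun x => single i x j) = id); first by move=> t; exact: cvg_id.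
  by apply/funext => t; rewrite /single ji.
rewrite (_ : (fun x => single i x j) = cst 0); first exact: cst_continuous.
by apply/funext => t; rewrite /single ji.
Qed.

Definition vanishes_on (F : seq I) (p : P) := forall i, i \in F -> p i = 0.

(** The points vanishing on a finite list form subgroups shrinking to 0, so [f] maps one of them
    into a small arc and hence to 0. *)
Lemma character_finite_support (f : {additive P -> T}) : continuous f ->
  exists F, forall p, vanishes_on F p -> f p = 0.
Proof.
move=> cf.
pose Phi : set_system P := filter_from setT (fun F : seq I => vanishes_on F).
have FPhi : Filter Phi.
  apply: filter_from_filter; first by exists [::].
  move=> s t _ _; exists (s ++ t) => // p pst; split=> i is_; apply: pst;
    by rewrite mem_cat is_ ?orbT.
have Phi0 : Phi --> (0 : P).
  apply/cvg_sup => i A [B [[W oW <-] W0 BA]]; exists [:: i] => // p pi.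
  apply: BA => /=; rewrite pi ?inE//; exact: W0.
have e4 : 0 < 1 / 4 :> R by lra.
have : nbhs (0 : P) (f @^-1` small (1 / 4)).
  by apply: cf; rewrite raddf0; exact: nbhs_small.
move=> /Phi0[F _ FP]; exists F => p pF.
apply: no_small_subgroups => m; rewrite -raddfMn; apply: FP => i iF.
elim: m => [//|m IH]; rewrite mulrS.
change (p i + (p *+ m) i = 0).
by rewrite IH pF// addr0.
Qed.

End TorusCharacters.

(** * Order properties of a well-order *)

Section WellOrder.
Variables (I : eqType) (le : rel I).
Hypothesis wo : well_order le.

Definition wo_lt : rel I := fun i j => le i j && (i != j).

Lemma wo_pick (A : {pred I}) i : i \in A ->
  exists2 z, z \in A & {in A, forall x, le z x}.
Proof. by move=> iA; have [z [[zA zl] _]] := wo (ex_intro _ i iA); exists z. Qed.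

Lemma wo_refl : reflexive le.
Proof.
move=> i; have [z] := @wo_pick (pred1 i) i (eqxx i).
by rewrite inE => /eqP -> /(_ i (eqxx i)).
Qed.

Lemma wo_total : total le.
Proof.
move=> i j; have [z] := @wo_pick (pred2 i j) i (predU1l _ erefl).
rewrite !inE => /orP[/eqP ->|/eqP ->] H; apply/orP; [left|right]; apply: H.
  by rewrite inE eqxx orbT.
by rewrite inE eqxx.
Qed.

(** Both elements are minima of the pair, and [well_order] includes uniqueness of the minimum. *)
Lemma wo_antisym i j : le i j -> le j i -> i = j.
Proof.
move=> ij ji; have [z [_ zu]] := wo (ex_intro _ i (predU1l _ erefl : i \in pred2 i j)).
have mi : minimum_of le (pred2 i j) i.
  by split; [rewrite inE eqxx|move=> x; rewrite inE => /orP[/eqP ->|/eqP ->//]; exact: wo_refl].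
have mj : minimum_of le (pred2 i j) j.
  split; first by rewrite inE eqxx orbT.
  by move=> x; rewrite inE => /orP[/eqP ->//|/eqP ->]; exact: wo_refl.
by rewrite -(zu i mi) -(zu j mj).
Qed.

Lemma wo_trans : transitive le.
Proof.
move=> j i k ij jk.
have [z] := @wo_pick (pred3 i j k) i (predU1l _ erefl).
have m x : (x == i) || (x == j) || (x == k) -> x \in pred3 i j k by rewrite inE orbA.
move=> /or3P[/eqP ->|/eqP ->|/eqP ->] H.
- by apply: H; apply: m; rewrite eqxx !orbT.
- have ji : le j i by apply: H; apply: m; rewrite eqxx.
  by rewrite (wo_antisym ij ji).
- have kj : le k j by apply: H; apply: m; rewrite eqxx orbT.
  by rewrite -(wo_antisym jk kj).
Qed.

Lemma wo_lt_wf : well_founded (fun i j => wo_lt i j).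
Proof.
move=> i; apply: contrapT => nA.
have [z] := @wo_pick (fun j => `[< ~ Acc (fun i j => wo_lt i j) j >]) i (asboolT nA).
move=> /asboolP nz zmin; apply: nz; constructor => j /andP[jz ne].
apply: contrapT => nj; have zj := zmin j (asboolT nj).
by rewrite (wo_antisym jz zj) eqxx in ne.
Qed.

Lemma seq_max (s : seq I) : s != [::] -> exists2 j, j \in s & forall i, i \in s -> le i j.
Proof.
elim: s => [//|i s IH] _; have [->|s0] := eqVneq s [::].
  by exists i; rewrite ?inE// => k; rewrite inE => /eqP ->; exact: wo_refl.
have [j js jm] := IH s0; have [ij|ji] := orP (wo_total i j).
  exists j; first by rewrite inE js orbT.
  by move=> k; rewrite inE => /orP[/eqP ->//|/jm].
exists i; first by rewrite inE eqxx.
move=> k; rewrite inE => /orP[/eqP ->|/jm kj]; first exact: wo_refl.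
exact: wo_trans kj ji.
Qed.

End WellOrder.

(** * A triangular family of characters *)

Section TriangularBasis.
Variables (R : realType) (I : choiceType).
Local Notation T := (circle R).
Local Notation P := (prod_topology (fun _ : I => T)).
Variable C : set (P -> T).
Hypotheses (Czmod : forall f, C f -> zmod_morphism f)
  (Ccont : forall f, C f -> continuous f)
  (Ccomb : forall f g (k : int), C f -> C g -> C (fun p => f p - g p *~ k)).
Variable le : rel I.
Hypothesis wo : well_order le.
Local Notation lt := (wo_lt le).

(** For additive [f] this says that [f] depends only on the coordinates up to [i]. *)
Definition below (i : I) (f : P -> T) :=
  forall p : P, (forall j, le j i -> p j = 0) -> f p = 0.

Let C0 f : C f -> f 0 = 0.
Proof. by move=> Cf; exact: (raddf0 (additive_of (Czmod Cf))). Qed.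

Let CB f p q : C f -> f (p - q) = f p - f q.
Proof. by move=> Cf; exact: Czmod. Qed.

Let CD f p q : C f -> f (p + q) = f p + f q.
Proof. by move=> Cf; exact: (raddfD (additive_of (Czmod Cf))). Qed.

Definition cut (i : I) (p : P) : P := fun j => if lt j i then p j else 0.

Lemma below_cut f i p : C f -> below i f -> f p = f (cut i p) + f (single i (p i)).
Proof.
move=> Cf fi; rewrite -CD//; apply/eqP; rewrite -subr_eq0 -CB//; apply/eqP/fi => j ji.
change (p j - ((if lt j i then p j else 0) + (if j == i then p i else 0)) = 0).
rewrite /wo_lt ji /=; have [->|_] := eqVneq j i; first by rewrite add0r subrr.
by rewrite addr0 subrr.
Qed.

Lemma support_below f (F : seq I) : C f -> (forall p, vanishes_on F p -> f p = 0) ->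
  (forall p, f p = 0) \/ exists2 j, j \in F & below j f.
Proof.
move=> Cf fF; have [F0|F0] := eqVneq F [::].
  by left => p; apply: fF; rewrite F0.
right; have [j jF jm] := seq_max wo F0; exists j => // p pj.
by apply: fF => i /jm; exact: pj.
Qed.

Lemma finite_support f : C f -> exists F, forall p, vanishes_on F p -> f p = 0.
Proof.
by move=> Cf; apply: (@character_finite_support R I (additive_of (Czmod Cf)));
  exact: Ccont.
Qed.

(* A character without [i]-coordinate depends on finitely many coordinates
   below [i], hence sits at a smaller level. *)
Lemma below_lt f i : C f -> below i f -> (forall t, f (single i t) = 0) ->
  (forall p, f p = 0) \/ exists2 j, lt j i & below j f.
Proof.
move=> Cf fi fsi; have [F FP] := finite_support Cf.
have [|//|[j]] := @support_below f [seq j <- F | lt j i] Cf; last first.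
- by rewrite mem_filter => /andP[ji _] fj; right; exists j.
- by left.
move=> p pF; rewrite (below_cut p Cf fi) fsi addr0; apply: FP => j jF.
by rewrite /cut; case: ifP => // ji; apply: pF; rewrite mem_filter ji.
Qed.

(** The [i]-th coefficients of the members of [C] at level [i] form a subgroup of the integers; [f]
    realises its positive generator [d]. *)
Definition leading (i : I) (f : P -> T) (d : nat) := [/\ C f, below i f, (0 < d)%N,
  (forall t, f (single i t) = t *+ d) &
  (forall g, C g -> below i g -> exists q : int,
     forall t, g (single i t) = f (single i t) *~ q)].

Lemma coefficient f i : C f -> exists n : int, forall t, f (single i t) = t *~ n.
Proof.
move=> Cf.
have sB : zmod_morphism (fun t => f (single i t)).
  by move=> s t; rewrite single_zmod_morphism CB.
apply: (@circle_character R (additive_of sB)) => t.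
by apply: (@continuous_comp _ _ _ (single i) f);
  [exact: continuous_single|exact: Ccont].
Qed.

(** The least positive coefficient divides all others, by Euclidean division carried out inside
    [C]. *)
Lemma leading_or_zero i : (exists f d, leading i f d) \/
  (forall f, C f -> below i f -> forall t, f (single i t) = 0).
Proof.
pose good (n : nat) := (0 < n)%N && `[< exists f, [/\ C f, below i f &
  forall t, f (single i t) = t *+ n] >].
have [[n gn]|ng] := pselect (exists n, good n); last first.
  right => f Cf fi t; have [n nE] := coefficient i Cf.
  have [n0|n0] := eqVneq n 0; first by rewrite nE n0 mulr0z.
  exfalso; apply: ng; exists `|n|%N; rewrite /good absz_gt0 n0; apply/asboolP.
  have [np|nn] := leP 0 n.
    by exists f; split => // s; rewrite nE pmulrn gez0_abs.
  (* This is [- f], written as a combination under which [C] is closed; it turns the negative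
     coefficient positive. *)
  exists (fun p => f p - f p *~ 2); split; first exact: Ccomb.
    by move=> p pi; rewrite fi// mul0rz subrr.
  move=> s; rewrite nE [RHS]pmulrn ltz0_abs// -mulrzA -mulrzBr; congr (_ *~ _); lia.
left; case: (ex_minnP (ex_intro _ n gn)) => d /andP[d0 /asboolP[f [Cf fi fd]]] dmin.
exists f, d; split => // g Cg gi; have [m mE] := coefficient i Cg.
exists (m %/ d)%Z => t.
suff m0 : (m %% d)%Z = 0.
  by rewrite mE fd pmulrn -mulrzA {1}(divz_eq m d) m0 addr0 mulrC.
apply/eqP; apply: contraT => m0.
have dz : d%:Z != 0 by rewrite eqz_nat -lt0n.
have : good `|(m %% d)%Z|%N.
  rewrite /good absz_gt0 m0; apply/asboolP.
  exists (fun p => g p - f p *~ (m %/ d)%Z); split; first exact: Ccomb.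
    by move=> p pi; rewrite gi// fi// mul0rz subrr.
  move=> s; rewrite mE fd (pmulrn s d) -mulrzA -mulrzBr pmulrn gez0_abs ?modz_ge0//.
  congr (_ *~ _); have := divz_eq m d; rewrite mulrC; lia.
move=> /dmin; rewrite leqNgt => /negP dm; exfalso; apply: dm.
by rewrite -ltz_nat gez0_abs ?modz_ge0// ltz_pmod.
Qed.

Variables (f_ : I -> P -> T) (d_ : I -> nat).
Hypothesis lead_ : forall i, (exists f d, leading i f d) -> leading i (f_ i) (d_ i).

Definition pivot i := exists f d, leading i f d.

(** Well-founded induction on the level: subtracting a multiple of [f_ i] removes the coordinate
    [i], and the remainder is zero or sits at a smaller level. *)
Lemma pivots_generate (p : P) : (forall i, pivot i -> f_ i p = 0) ->
  forall f, C f -> f p = 0.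
Proof.
move=> pz.
have key i : forall f, C f -> below i f -> f p = 0.
  elim/(well_founded_ind (wo_lt_wf wo)): i => i IH f Cf fi.
  have [k kE] : exists k : int, forall t,
      f (single i t) = f_ i (single i t) *~ k /\ (pivot i \/ k = 0).
    have [pi|z] := leading_or_zero i; last by exists 0 => t; rewrite z// mulr0z; split => //; right.
    have [Cfi fii _ _ /(_ f Cf fi)[k kE]] := lead_ pi.
    by exists k => t; split => //; left.
  have [pi|npi] := pselect (pivot i); last first.
    have fsi t : f (single i t) = 0.
      by have [e [//|k0]] := kE t; rewrite e k0 mulr0z.
    by have [->//|[j ji fj]] := below_lt Cf fi fsi; exact: IH ji _ Cf fj.
  have [Cfi fii _ _ _] := lead_ pi.
  have Cg := Ccomb k Cf Cfi; set g := (fun p => _) in Cg.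
  have gi : below i g by move=> q qi; rewrite /g fi// fii// mul0rz subrr.
  have gsi t : g (single i t) = 0 by rewrite /g (kE t).1 subrr.
  have g0 : g p = 0.
    by have [->//|[j ji gj]] := below_lt Cg gi gsi; exact: IH ji _ Cg gj.
  by move: g0; rewrite /g pz// mul0rz subr0.
move=> f Cf; have [F FP] := finite_support Cf.
by have [->//|[j _ fj]] := support_below Cf FP; exact: key fj.
Qed.

Lemma circle_divide (t : T) (d : nat) : (0 < d)%N -> exists s : T, s *+ d = t.
Proof.
move=> d0; have [x <-] := toT_surj t; exists (toT R (x / d%:R)).
by rewrite -raddfMn -(mulr_natr (x / d%:R)) divfK// pnatr_eq0 -lt0n.
Qed.

(* The system [f_ i p = t i] is triangular, with diagonal coefficients [d_ i]
   by which the circle is divisible. *)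
Lemma pivots_solvable (t : I -> T) : exists p : P, forall i, pivot i -> f_ i p = t i.
Proof.
(* Division is made total so that the recursion can run through all indices; its result matters only
   at pivots, where [d_ i] is positive. *)
have /choice[div divP] : forall sd : T * nat, exists s : T, (0 < sd.2)%N -> s *+ sd.2 = sd.1.
  move=> [s d]; have [d0|] := ltnP 0 d; last by exists 0.
  by have [u uE] := circle_divide s d0; exists u.
pose step (i : I) (rec : forall j, lt j i -> T) : T :=
  div (t i - f_ i (fun j => if pselect (lt j i) is left h then rec j h else 0), d_ i).
pose p : P := Fix (wo_lt_wf wo) (fun _ => T) step.
have pE i : p i = div (t i - f_ i (cut i p), d_ i).
  rewrite {1}/p Fix_eq; last first.
    move=> j g h gh; rewrite /step; congr (div (_ - f_ j _, _)).
    by apply/funext => k; case: pselect.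
  rewrite /step; congr (div (_ - f_ i _, _)); apply/funext => j.
  by rewrite /cut; case: pselect => [h|/negP/negbTE]; [rewrite h|move=> ->].
exists p => i pi; have [Cfi fii d0 fd _] := lead_ pi.
rewrite (below_cut p Cfi fii) fd pE (divP (_, _))//=.
by rewrite addrC subrK.
Qed.

End TriangularBasis.

Lemma continuous_mulrz (X : topologicalType) (G : topologicalZmodType) (f : X -> G)
  (k : int) : continuous f -> continuous (fun x => f x *~ k).
Proof.
move=> cf.
have cn (n : nat) : continuous (fun x => f x *+ n).
  elim: n => [|n IH]; first by move=> x; exact: cvg_cst.
  rewrite (_ : (fun _ => _) = fun x => f x + f x *+ n); first exact: continuous_addr.
  by apply/funext => x; rewrite mulrS.
case: k => n; first exact: cn.
rewrite (_ : (fun _ => _) = fun x => - (f x *+ n.+1)); last first.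
  by apply/funext => x; rewrite NegzE mulrNz pmulrn.
by apply: continuous_fcomp; [exact: cn|exact: continuous_oppr].
Qed.

(** * A divisible compact group with trivial extensions is a torus *)

Section TorusRetract.
Variables (R : realType) (G : topologicalZmodType).
Hypotheses (hG : hausdorff_space G) (cG : compact [set: G]) (dG : divisible G).
Local Notation T := (circle R).

(** [{classic _}] equips the index set with decidable equality and choice, which the coordinates and
    the well-order require. *)
Definition characters : Type :=
  {classic {chi : {additive G -> T} | continuous chi}}.

Local Notation P := (prod_topology (fun _ : characters => T)).

Definition ev (g : G) : P := fun chi => sval chi g.

Lemma ev_zmod_morphism : zmod_morphism ev.
Proof. by move=> g h; apply/funext => chi; rewrite /ev raddfB. Qed.

HB.instance Definition _ := GRing.isZmodMorphism.Build G P ev ev_zmod_morphism.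

Lemma continuous_ev : continuous ev.
Proof. by apply: continuous_to_prod => chi; exact: (svalP chi). Qed.

Lemma ev_injective : injective ev.
Proof.
move=> g h gh; apply/eqP; rewrite -subr_eq0; apply/negPn/negP => gh0.
have [x|chi [cchi]] := enough_characters R hG cG _ gh0.
  by have [y yx] := @dG 2 x isT; exists y.
rewrite raddfB (_ : chi g = chi h) ?subrr ?eqxx//.
exact: (congr1 (fun p : P => p (exist _ chi cchi : characters)) gh).
Qed.

Lemma torus_hausdorff (I : eqType) : hausdorff_space (prod_topology (fun _ : I => T)).
Proof. by apply: (@hausdorff_product I (fun _ => T)) => _; exact: circle_hausdorff. Qed.

Lemma torus_compact (I : eqType) : compact [set: prod_topology (fun _ : I => T)].
Proof.
have := @tychonoff I (fun _ => T) (fun _ => setT) (fun _ => @circle_compact R).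
by congr compact; apply/seteqP; split.
Qed.

Lemma torus_divisible (I : Type) : divisible (prod_topology (fun _ : I => T)).
Proof.
move=> n p n0.
have /choice[q qE] : forall i, exists s : T, s *+ n = p i.
  by move=> i; exact: circle_divide.
exists q; rewrite -[RHS](_ : (fun i => q i *+ n) = p); last by apply/funext.
elim: n {n0 qE} => [//|n IH]; rewrite mulrS IH.
by apply/funext => i; rewrite mulrS.
Qed.

Hypothesis Gext : forall X : topologicalZmodType, LCA X -> Ext_tfu_trivial X G.

Lemma torus_retraction : exists r : {additive P -> G}, continuous r /\ cancel ev r.
Proof.
have lP := compact_locally_compact (@torus_compact characters).
have hP := @torus_hausdorff characters.
have LX := coker_LCA cG hP continuous_ev lP.
have tfu := coker_tfu_divisible cG hP continuous_ev ev_injective dG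
  (@torus_divisible characters).
exact: (splits_retraction (Gext LX (conj hP lP) tfu)).
Qed.

Lemma torus_iso : exists (sigma : choiceType)
  (F : {additive G -> prod_topology (fun _ : sigma => T)}), topological_iso F.
Proof.
have [r [cr rK]] := torus_retraction.
(* The dual of [G], realised as characters of the torus by composing with the retraction. *)
pose C : set (P -> T) :=
  [set f | exists chi : {additive G -> T}, continuous chi /\ f = chi \o r].
have Czmod f : C f -> zmod_morphism f.
  by move=> [chi [_ ->]] p q; rewrite /= !raddfB.
have Ccont f : C f -> continuous f.
  by move=> [chi [cchi ->]]; exact: continuous_fcomp.
have Ccomb f g (k : int) : C f -> C g -> C (fun p => f p - g p *~ k).
  move=> [chi [cchi ->]] [psi [cpsi ->]].
  have B : zmod_morphism (fun x => chi x - psi x *~ k).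
    move=> x y; rewrite (raddfB chi) (raddfB psi) mulrzBl !opprB.
    by rewrite (addrC (psi y *~ k)) addrACA; congr (_ + _); rewrite addrC.
  exists (additive_of B); split => //.
  by apply: continuous_subr => //; exact: continuous_mulrz.
have [le wo] := well_ordering_principle characters.
have /choice[fd fdP] : forall i, exists fd : (P -> T) * nat,
    pivot C le i -> leading C le i fd.1 fd.2.
  move=> i; have [[f [d L]]|n] := pselect (pivot C le i).
    by exists (f, d).
  by exists (fun=> 0, 0%N) => /n.
pose f_ i := (fd i).1; pose d_ i := (fd i).2.
have lead_ i : pivot C le i -> leading C le i (f_ i) (d_ i) by exact: fdP.
pose sigma : choiceType := {i : characters | `[< pivot C le i >]}.
have piv (s : sigma) : pivot C le (val s) by exact/asboolP/(valP s).
have Cf (s : sigma) : C (f_ (val s)) by have [] := lead_ _ (piv s).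
pose F0 (g : G) : prod_topology (fun _ : sigma => T) := fun s => f_ (val s) (ev g).
have F0B : zmod_morphism F0.
  by move=> g h; apply/funext => s; rewrite /F0 raddfB (Czmod _ (Cf s)).
have cF0 : continuous F0.
  apply: continuous_to_prod => s; apply: continuous_fcomp; first exact: continuous_ev.
  exact: Ccont (Cf s).
have injF : injective F0.
  move=> g h gh; apply: ev_injective; apply/funext => chi.
  (* Since [r] undoes [ev], this value is [chi (g - h)]; its vanishing for every [chi] identifies
     [ev g] and [ev h]. *)
  suff H : (sval chi \o r) (ev (g - h)) = 0.
    by apply/eqP; rewrite -subr_eq0 -[X in X == _](raddfB (sval chi)) -[g - h]rK; apply/eqP.
  apply: (@pivots_generate R characters C Czmod Ccont Ccomb le wo f_ d_ lead_).
    move=> i pi; have pib : `[< pivot C le i >] by exact/asboolP.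
    have := congr1 (fun p => p (exist _ i pib : sigma)) gh.
    have [Cfi _ _ _ _] := lead_ i pi.
    by rewrite /F0 /= => e; rewrite raddfB (Czmod _ Cfi) e subrr.
  by exists (sval chi); split => //; exact: (svalP chi).
have surjF t : exists g, F0 g = t.
  pose t' i : T := if pselect (`[< pivot C le i >]) is left h then t (exist _ i h) else 0.
  have [p pP] := @pivots_solvable R characters C Czmod le wo f_ d_ lead_ t'.
  exists (r p); apply/funext => -[i ib]; rewrite /F0 /=.
  have [chi [_ fE]] := Cf (exist _ i ib); rewrite /= in fE.
  (* A solution in the torus may be replaced by its image in [G], because [f_ i] factors through
     [r]. *)
  have -> : f_ i (ev (r p)) = f_ i p by rewrite fE /= rK.
  rewrite pP; last exact/asboolP.
  rewrite /t'; case: pselect => // h; congr (t _); exact: val_inj.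
have /choice[Finv FinvK] := surjF.
have FK : cancel F0 Finv by move=> g; apply: injF; rewrite FinvK.
exists sigma, (additive_of F0B); split => //.
exists Finv; last by split.
apply/continuous_closedP => A clA.
rewrite (_ : _ @^-1` _ = F0 @` A).
  by apply: compact_to_hausdorff_closed => //; exact: torus_hausdorff.
apply/seteqP; split=> [t At|_ [g Ag <-]]; first by exists (Finv t).
by rewrite /= FK.
Qed.

End TorusRetract.

(** The two added factors, row vectors of length 0 and a product over the empty type, are zero
    groups. *)
Lemma isomorphic_padding (R : realType) (G S : topologicalZmodType) (F : {additive G -> S}) :
  topological_iso F ->
  isomorphic G (dirsum (dirsum S 'rV[R]_0)
    (prod_topology (fun i : void => discrete_topology 'I_(of_void nat i).+1))).
Proof.
move=> [cF [Finv cFinv [FK FinvK]]].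
set Q := prod_topology _.
have Q0 (x y : Q) : x = y by apply: functional_extensionality_dep => -[].
pose E (g : G) : dirsum (dirsum S 'rV[R]_0) Q := ((F g, 0), 0).
have EB : zmod_morphism E.
  move=> g h; congr pair; last exact: Q0.
  by congr pair; [exact: raddfB|exact/esym/thinmx0].
exists (additive_of EB); split.
  move=> g U [[V W] /= [[[V1 V2] /= [nV1 nV2] V12] nW] VW].
  apply: (@filterS _ (nbhs g) _ _ _ _ (cF g V1 nV1)) => h V1h.
  by apply: VW; split => /=; [apply: V12; split => //=|]; exact: nbhs_singleton.
exists (fun z => Finv z.1.1).
  apply: (@continuous_fcomp _ _ _ (fun z : dirsum (dirsum S 'rV[R]_0) Q => z.1.1)) => //.
  apply: (@continuous_fcomp _ _ _ (fst : dirsum (dirsum S 'rV[R]_0) Q -> dirsum S 'rV[R]_0) fst).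
    by move=> z; exact: cvg_fst.
  by move=> z; exact: cvg_fst.
split=> [g|[[s v] q]]; first exact: FK.
congr pair; last exact: Q0.
by congr pair; [exact: FinvK|rewrite thinmx0].
Qed.

Theorem lemma3p2 (R : realType) (G : topologicalZmodType)
    (G_hausdorff : hausdorff_space G)
    (G_compact : compact [set: G])
    (G_ext : forall X : topologicalZmodType, LCA X -> Ext_tfu_trivial X G) :
  exists (sigma : Type) (n : nat) (I : Type) (k : I -> nat),
    isomorphic G
      (dirsum (dirsum (prod_topology (fun _ : sigma => circle R)) 'rV[R]_n)
              (prod_topology (fun i : I => discrete_topology 'I_(k i).+1))).
Proof.
have G_div : divisible G.
  by move=> n x n0; exact: divides_of_Ext.
have [sigma [F isoF]] := torus_iso R G_hausdorff G_compact G_div G_ext.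
(* The exponent 0 is forced: a compact group has no nonzero real vector space as a topological
   direct factor. *)
by exists sigma, 0%N, void, (of_void nat); exact: isomorphic_padding isoF.
Qed.
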